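(* For $n\ge3$ and $k\ge2$, let $b(n,k)=|\{\pi\in\mathcal{S}_n:\overline{N}(\pi)=k\}|$, where $\overline{N}(\pi)=\min\{k\ge2:\pi\in\operatorname{Allow}(\Sigma_{-k})\}$, and let $$p(n,k)=a(n,k)+(k^2-2)k^{n-3}-2\sum_{j=1}^{k-1}j^{n-3}-2\sum_{\substack{c=1\\ c\text{ odd}}}^{\lfloor\frac{n-1}{2}\rfloor}\ \sum_{j=1}^{k-1}\binom{c+k-j-2}{k-j}j^{n-2c-1}\psi_j(c),$$ where $\psi_k(t)=\sum_{d\mid t}\mu(d)k^{t/d}$ ($\mu$ the Möbius function) and $a(n,k)=\sum_{i=1}^{n-1}k^{n-i-1}\psi_k(i)$. Then $$p(n,k)=\sum_{j=2}^{k}\binom{n+k-j-1}{k-j}\,b(n,j).$$ Equivalently, $$b(n,k)=\sum_{j=2}^{k}(-1)^{k-j}\binom{n}{k-j}\,p(n,j).$$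
   Context: **Negative shift.** For $k\ge2$ let $\mathcal{W}_k$ be the set of infinite words $w=w_1w_2\cdots$ on $\{0,\dots,k-1\}$, ordered by: for $v\ne w$ with first difference at position $j$, $v<w$ iff $(-1)^{j-1}(w_j-v_j)>0$. The $-k$-shift $\Sigma_{-k}:\mathcal{W}_k\to\mathcal{W}_k$ is $w_1w_2w_3\cdots\mapsto w_2w_3\cdots$. A permutation $\pi\in\mathcal{S}_n$ is in $\operatorname{Allow}_n(\Sigma_{-k})\subseteq\operatorname{Allow}(\Sigma_{-k})$ iff there is $w\in\mathcal{W}_k$ such that the words $w_iw_{i+1}\cdots$ ($1\le i\le n$) are distinct and in the same relative order (with respect to this order) as $\pi_1,\dots,\pi_n$. Here $\mathcal{S}_n$ is the symmetric group on $\{1,\dots,n\}$, and $b(n,k)$ is the number of permutations of length $n$ realized by the $-k$-shift but by no $-k'$-shift with $2\le k'<k$. Binomial coefficients have the usual convention $\binom{m}{r}=0$ for $0\le m<r$. *)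

(* Defs.v *)
From mathcomp Require Import all_boot all_order all_algebra all_fingroup.
From mathcomp Require Import boolp.

Set Implicit Arguments.
Unset Strict Implicit.
Unset Printing Implicit Defensive.

Import GRing.Theory.
Local Open Scope ring_scope.

(* Positions are numbered from 0: w i is the letter w_{i+1}. *)
Definition word (k : nat) := nat -> 'I_k.

(* With j counted from 0, the sign (-1)^(j-1) of the 1-based convention is
   (-1)^j. *)
Definition word_lt (k : nat) (v w : word k) : Prop :=
  exists j : nat,
    (forall i : nat, (i < j)%N -> v i = w i) /\
    0 < (-1) ^+ j * ((w j : nat)%:Z - (v j : nat)%:Z).

Definition shift (k : nat) (w : word k) : word k := fun i => w i.+1.

(* S_n is rendered as the permutations of 'I_n = {0, ..., n-1}; pi i stands
   for pi_{i+1} - 1, which does not affect the relative order. *)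
Definition allowed (n k : nat) (pi : 'S_n) : Prop :=
  exists w : word k,
    injective (fun i : 'I_n => iter i (@shift k) w) /\
    forall i j : 'I_n,
      (pi i < pi j)%N <-> word_lt (iter i (@shift k) w) (iter j (@shift k) w).

(* The value 0 is a default for the minimum of an empty set; it is never
   equal to a k >= 2. *)
Definition Nbar (n : nat) (pi : 'S_n) : nat :=
  match pselect (exists k : nat, (2 <= k)%N && `[< allowed k pi >]) with
  | left ex => ex_minn ex
  | right _ => 0%N
  end.

Lemma NbarP (n k : nat) (pi : 'S_n) : (2 <= k)%N ->
  Nbar pi = k <->
  allowed k pi /\
  forall k' : nat, (2 <= k')%N -> (k' < k)%N -> ~ allowed k' pi.
Proof.
move=> hk; rewrite /Nbar; case: pselect => [ex|nex]; last first.
  split=> [k0|[ak _]]; first by rewrite -k0 in hk.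
  by case: nex; exists k; rewrite hk; apply/asboolP.
case: ex_minnP => m /andP[hm /asboolP am] min_m; split=> [<-|[ak min_k]].
  split=> // k' hk' lt_k'm ak'; have := min_m k'.
  by rewrite hk' leqNgt lt_k'm; move=> /(_ (introT (asboolP _) ak')).
apply/eqP; rewrite eqn_leq min_m ?hk ?(introT (asboolP _) ak) //=.
by rewrite leqNgt; apply/negP => /(min_k m hm).
Qed.

Definition b (n k : nat) : nat := #|[set pi : 'S_n | Nbar pi == k]|.

(* Only used for d > 0. *)
Definition moebius (d : nat) : int :=
  if all (fun q => logn q d == 1%N) (primes d)
  then (-1) ^+ size (primes d) else 0.

Definition psi (k t : nat) : int :=
  \sum_(d <- divisors t) moebius d * k%:Z ^+ (t %/ d).

Definition a (n k : nat) : int :=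
  \sum_(1 <= i < n) k%:Z ^+ (n - i - 1) * psi k i.

(* For n >= 3 and k >= 2 none of the subtractions in nat below truncates. *)
Definition p (n k : nat) : int :=
  a n k + (k%:Z ^+ 2 - 2) * k%:Z ^+ (n - 3)
  - 2 * (\sum_(1 <= j < k) j%:Z ^+ (n - 3))
  - 2 * (\sum_(1 <= c < ((n - 1) %/ 2).+1 | odd c) \sum_(1 <= j < k)
           'C(c + k - j - 2, k - j)%:Z * j%:Z ^+ (n - 2 * c - 1) * psi j c).

(* Main.v *)
Require Import Defs.
From mathcomp Require Import all_boot all_order all_algebra all_fingroup.
From mathcomp Require Import boolp zify ring.
Set Implicit Arguments.
Unset Strict Implicit.
Unset Printing Implicit Defensive.

(** Put N = n - 1.  Call the first N letters s of a word its prefix, let x be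
    the rest, so that x is its shift by N, and let q_t be the suffix of s of
    length t, so that the shift by N - t is q_t x.  Let y^oo be the infinite
    repetition of y.

    The shift reverses the order of two words with the same first letter, so if
    s x realizes pi then s is compatible with pi: its letters weakly increase
    with pi, and equal letters at i and j force pi to order i + 1 and j + 1 the
    other way.  The theorem counts the pairs (pi, s) that are realized by some
    tail x in two ways.

    Fix s.  The map x |-> q_t x moves every x to the side of x on which its
    fixed point q_t^oo lies (lemmas tail_lt and tail_gt), so the permutation
    realized by s x depends only on the position of x among the points q_t^oo.
    There are as many distinct points as primitive suffixes, hence one
    more interval than primitive suffixes; but the lowest interval is empty when
    s ends in 0 (k-1), for the lowest point is then the least word, and the
    highest one is empty when s ends in (k-1) 0.  With the Moebius inversion for
    the number of primitive words, the sum over s is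
    a(n,k) + (k^2 - 2) k^(n-3), the first part of p(n,k).  (Below, the two
    empty intervals are counted first and subtracted at the end, with the traps.)

    Fix pi.  Listed in the order of pi, the letters of a compatible s form a
    weakly increasing chain between 0 and k - 1 with n steps, d of which must be
    strict, where d depends on pi only.  There are as many of them as multisets
    of size k - 1 - d with n types of elements.  A compatible pair may still not be
    realizable.  This happens in two ways, called traps below.  In a spiral trap,
    s ends in q q with q primitive of odd length c, and pi puts x strictly between
    q x and q q x: no word lies there, because both comparisons of x are with
    q^oo. In an extreme trap, s ends in 0 (k-1) and x must be below all other
    shifts, or s ends in (k-1) 0 and x must be above them. A permutation admits
    at most one kind of trap (lemma trap_unique), and a trapped s is a chain in
    which c steps, or two steps in the extreme case, are equalities. So the
    trapped words of pi are counted by the multisets with n - c (or n - 2)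
    types. It follows that
    Nbar pi is d + 1 if pi has no trap and d + 2 otherwise, and an addition
    formula for numbers of multisets expresses the wanted weight
    'C(n + k - Nbar pi - 1, k - Nbar pi) by the numbers of compatible and of
    trapped words for pi over alphabets of size at most k (lemma perm_identity).

    Summing over pi gives the first formula.  The number of trapped pairs of each
    kind is easily found from the side of s, since each s admits at most one
    permutation per kind (lemmas card_spiral and card_bottom_trap).  The second
    formula is the inversion of the first one: the weights are the
    coefficients of (1 - X)^(-n). *)

(** * The alternating order on words *)

(** The order of the statement on words with natural letters: forgetting the
    size of the alphabet allows arithmetic on letters and the use of a letter
    outside the alphabet. *)
Definition alt_lt (v w : nat -> nat) : Prop :=
  exists j, (forall i, i < j -> v i = w i) /\ (if odd j then w j < v j else v j < w j).

Definition tail (w : nat -> nat) i := fun m => w (i + m).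

Lemma alt_lt_irr v : ~ alt_lt v v.
Proof. by case=> j [_]; rewrite ltnn; case: ifP. Qed.

Lemma alt_lt_trans v u w : alt_lt v u -> alt_lt u w -> alt_lt v w.
Proof.
case=> i [hi di] [j [hj dj]]; case: (ltngtP i j) => ij.
- exists i; split; last by rewrite -(hj _ ij).
  by move=> m mi; rewrite hi // hj //; lia.
- exists j; split; last by rewrite (hi _ ij).
  by move=> m mi; rewrite hi ?hj //; lia.
- subst j; exists i; split; first by move=> m mi; rewrite hi ?hj.
  by move: di dj; case: ifP => _; lia.
Qed.

Lemma alt_lt_asym v w : alt_lt v w -> ~ alt_lt w v.
Proof. by move=> vw wv; apply: (@alt_lt_irr v); apply: alt_lt_trans wv. Qed.

Lemma alt_lt_total v w : [\/ alt_lt v w, v = w | alt_lt w v].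
Proof.
case: (pselect (exists j, v j != w j)) => [ex|nex]; last first.
  constructor 2; apply/funext => j; apply: contrapT => /eqP vw.
  by apply: nex; exists j.
case: (ex_minnP ex) => j vwj min_j.
have eqj i : i < j -> v i = w i.
  by move=> ij; apply/eqP; apply: contraT => /min_j; lia.
case hj: ((if odd j then w j < v j else v j < w j)).
  by constructor 1; exists j.
constructor 3; exists j; split; first by move=> i /eqj ->.
by move: hj vwj; case: ifP => _; lia.
Qed.

(** The recursive form of the order: equal first letters are removed at the
    price of exchanging the two words. *)
Lemma alt_lt_cons v w :
  alt_lt v w <-> v 0 < w 0 \/ (v 0 = w 0 /\ alt_lt (tail w 1) (tail v 1)).
Proof.
split.
  case=> [[|j]] [eqj dj]; first by left.
  right; split; first exact: eqj.
  exists j; split; first by move=> i ij; rewrite /tail !add1n eqj.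
  by move: dj; rewrite /= /tail !add1n; case: (odd j).
case=> [lt0|[eq0 [j [eqj dj]]]]; first by exists 0.
exists j.+1; split.
  by case=> [//|i] ij; rewrite -[i.+1]add1n; apply/esym/eqj.
by move: dj; rewrite /= /tail !add1n; case: (odd j).
Qed.

Lemma tail_tail w i j : tail (tail w i) j = tail w (i + j).
Proof. by apply/funext => m; rewrite /tail addnA. Qed.

Lemma tail_cons w i j :
  alt_lt (tail w i) (tail w j) <->
  w i < w j \/ (w i = w j /\ alt_lt (tail w j.+1) (tail w i.+1)).
Proof. by rewrite alt_lt_cons !tail_tail !addn1 /tail !addn0. Qed.

Lemma tail_eq_cons w i j :
  tail w i = tail w j <-> w i = w j /\ tail w i.+1 = tail w j.+1.
Proof.
split=> [e|[e0 e]].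
  split; first by have := congr1 (@^~ 0) e; rewrite /tail /= !addn0.
  by rewrite -[i.+1]addn1 -[j.+1]addn1 -!tail_tail e.
apply/funext => -[|m]; first by rewrite /tail !addn0.
by have := congr1 (@^~ m) e; rewrite /tail /= !addSnnS.
Qed.

Definition prepend (s : nat -> nat) N (x : nat -> nat) :=
  fun i => if i < N then s i else x (i - N).

(** The infinite repetition of the last t letters of a word of length N. *)
Definition loop (s : nat -> nat) N t := fun m => s (N - t + m %% t).

Lemma prepend_prefix s N x i : i < N -> prepend s N x i = s i.
Proof. by rewrite /prepend => ->. Qed.

Lemma tail_prepend s N x : tail (prepend s N x) N = x.
Proof.
apply/funext => m; rewrite /tail /prepend ifF ?addKn //; lia.
Qed.

(** * Periodic words and primitive suffixes *)

Section Critical.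
Variables (s : nat -> nat) (N : nat).
Implicit Types (x : nat -> nat) (t : nat).

Lemma loop_period t m : loop s N t (m + t) = loop s N t m.
Proof. by rewrite /loop modnDr. Qed.

Lemma loop_small t i : t <= N -> i < t -> loop s N t i = s (N - t + i).
Proof. by move=> tN it; rewrite /loop modn_small. Qed.

(** If x agrees with q_t^oo on m letters, then q_t x agrees with q_t^oo on m + t
    letters.  Hence x and q_t x differ for the first time where x and q_t^oo do,
    and x compares with q_t x as it compares with q_t^oo. *)
Lemma tail_prepend_agree x t m : 0 < t <= N ->
  (forall i, i < m -> x i = loop s N t i) ->
  forall i, i < m + t -> tail (prepend s N x) (N - t) i = loop s N t i.
Proof.
move=> ht eqx i im; rewrite /tail /prepend; case: ifP => hi.
  by rewrite loop_small //; lia.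
have -> : N - t + i - N = i - t by lia.
rewrite eqx; last by lia.
rewrite -{2}(@subnK t i); last by lia.
by rewrite loop_period.
Qed.

Lemma tail_fix x t : 0 < t <= N -> tail (prepend s N x) (N - t) = x <-> x = loop s N t.
Proof.
move=> ht; split=> [e|->]; last first.
  by apply/funext => i; apply: (@tail_prepend_agree _ t i.+1) => //; lia.
apply/funext => i; have [n] := ubnP i; elim: n i => // n IH i ni.
rewrite -e; apply: (@tail_prepend_agree _ _ i) => // [j ji|]; last by lia.
by apply: IH; lia.
Qed.

Lemma tail_cmp x t : 0 < t <= N ->
  (alt_lt x (loop s N t) -> alt_lt x (tail (prepend s N x) (N - t))) /\
  (alt_lt (loop s N t) x -> alt_lt (tail (prepend s N x) (N - t)) x).
Proof.
move=> ht; split=> -[j [eqj dj]].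
  have ag := tail_prepend_agree ht eqj.
  exists j; split=> [i ij|]; first by rewrite ag ?eqj //; lia.
  by rewrite ag //; lia.
have eqj' i : i < j -> x i = loop s N t i by move/eqj.
have ag := tail_prepend_agree ht eqj'.
exists j; split=> [i ij|]; first by rewrite ag ?eqj //; lia.
by rewrite ag //; lia.
Qed.

Lemma tail_lt x t : 0 < t <= N ->
  alt_lt x (tail (prepend s N x) (N - t)) <-> alt_lt x (loop s N t).
Proof.
move=> ht; have [h1 h2] := tail_cmp x ht; split=> // h.
case: (alt_lt_total x (loop s N t)) => // [e|/h2 h'].
  by move/(tail_fix _ ht): e h => ->; move/alt_lt_irr.
by case: (alt_lt_asym h).
Qed.

Lemma tail_gt x t : 0 < t <= N ->
  alt_lt (tail (prepend s N x) (N - t)) x <-> alt_lt (loop s N t) x.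
Proof.
move=> ht; have [h1 h2] := tail_cmp x ht; split=> // h.
case: (alt_lt_total x (loop s N t)) => // [/h1 h'|e].
  by case: (alt_lt_asym h).
by move/(tail_fix _ ht): e h => ->; move/alt_lt_irr.
Qed.

Lemma period_mul (x : nat -> nat) t : (forall m, x (m + t) = x m) ->
  forall u m, x (m + u * t) = x m.
Proof.
move=> hx; elim=> [|u IH] m; first by rewrite mul0n addn0.
by rewrite mulSn addnA IH hx.
Qed.

Lemma period_gcd (x : nat -> nat) t t' : 0 < t ->
  (forall m, x (m + t) = x m) -> (forall m, x (m + t') = x m) ->
  forall m, x (m + gcdn t t') = x m.
Proof.
move=> t0 xt xt' m; have [u v uv _] := @egcdnP t t' t0.
rewrite -(@period_mul _ _ xt' v) -addnA [gcdn _ _ + _]addnC -uv.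
by rewrite (@period_mul _ _ xt).
Qed.

(** A cyclic shift of the repeated block does not matter here: g divides t, so
    the last g letters of the block are also its first g letters. *)
Lemma loop_of_period g t : 0 < t <= N -> g %| t ->
  (forall m, loop s N t (m + g) = loop s N t m) -> loop s N g = loop s N t.
Proof.
move=> ht gt xg; have g0 : 0 < g by apply: dvdn_gt0 gt; lia.
have gle : g <= t by apply: dvdn_leq => //; lia.
have xmod m : loop s N t (m %% g) = loop s N t m.
  by rewrite [in RHS](divn_eq m g) addnC (@period_mul _ _ xg).
apply/funext => m; rewrite {1}/loop -[RHS]xmod.
have lt1 : m %% g < g by rewrite ltn_mod.
have -> : N - g + m %% g = N - t + (t - g + m %% g) by lia.
rewrite -loop_small; [|lia|lia].
have [q hq] : exists q, t - g = q * g.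
  by case/dvdnP: gt => q eq; exists q.-1; rewrite {1}eq -subn1 mulnBl mul1n.
by rewrite hq addnC (@period_mul _ _ xg).
Qed.

(** Two periods of an infinite word give their gcd as a period, so words q_t^oo
    that agree are powers of a common root. *)
Lemma loop_gcd t t' : 0 < t <= N -> 0 < t' <= N -> loop s N t = loop s N t' ->
  loop s N (gcdn t t') = loop s N t.
Proof.
move=> ht ht' e; apply: loop_of_period => //; first exact: dvdn_gcdl.
apply: period_gcd; [lia|exact: loop_period|by move=> m; rewrite e loop_period].
Qed.

(** The block of length c is the shortest suffix with its repetition; by
    [loop_gcd] this is primitivity in the usual sense.  With this form the
    distinct points q_t^oo correspond to the primitive suffixes. *)
Definition primitive_suffix c := forall e, 0 < e < c -> loop s N e <> loop s N c.

Lemma primitive_suffix_dvd c t : 0 < c <= N -> 0 < t <= N -> primitive_suffix c ->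
  loop s N t = loop s N c -> c %| t.
Proof.
move=> hc ht pc e; have := loop_gcd hc ht (esym e).
set g := gcdn c t => eg.
have : g <= c by apply: dvdn_leq; [lia|exact: dvdn_gcdl].
rewrite leq_eqVlt => /orP[/eqP <-|lt]; first exact: dvdn_gcdr.
case: (pc g) => //; rewrite lt andbT gcdn_gt0; lia.
Qed.

(** A primitive block differs from its proper cyclic shifts. *)
Lemma primitive_suffix_shift c m : 0 < c <= N -> primitive_suffix c ->
  tail (loop s N c) m = loop s N c -> c %| m.
Proof.
move=> hc pc e; have xm u : loop s N c (u + m) = loop s N c u.
  by rewrite addnC; have := congr1 (@^~ u) e.
have c0 : 0 < c by lia.
have := loop_of_period hc (dvdn_gcdl c m) (period_gcd c0 (loop_period c) xm).
set g := gcdn c m => eg.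
have : g <= c by apply: dvdn_leq; [lia|exact: dvdn_gcdl].
rewrite leq_eqVlt => /orP[/eqP <-|lt]; first exact: dvdn_gcdr.
case: (pc g) => //; rewrite lt andbT gcdn_gt0; lia.
Qed.

Lemma root_exists t : 0 < t <= N ->
  exists c, [/\ 0 < c <= t, primitive_suffix c & loop s N c = loop s N t].
Proof.
have [n] := ubnP t; elim: n t => // n IH t nt ht.
case: (pselect (primitive_suffix t)) => [pr|npr]; first by exists t; split=> //; lia.
have [e [he ee]] : exists e, 0 < e < t /\ loop s N e = loop s N t.
  apply: contrapT => nex; apply: npr => e he ee; apply: nex; by exists e.
have [||c [hc pc ec]] := IH e; try lia.
by exists c; split=> //; [lia|rewrite ec].
Qed.

Lemma loop_mul_letters c l : 0 < c -> 0 < l -> l * c <= N ->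
  loop s N (l * c) = loop s N c ->
  forall i, N - l * c <= i -> i + c < N -> s (i + c) = s i.
Proof.
move=> c0 l0 lN e i hi iN.
have h j : j < l * c -> s (N - l * c + j) = loop s N c j.
  by move=> hj; rewrite -e loop_small.
have -> : i = N - l * c + (i - (N - l * c)) by lia.
by rewrite -addnA !h ?loop_period //; lia.
Qed.

Lemma loop_mul_of_letters c l : 0 < c -> 0 < l -> l * c <= N ->
  (forall i, N - l * c <= i -> i + c < N -> s (i + c) = s i) ->
  loop s N (l * c) = loop s N c.
Proof.
move=> c0 l0 lN h.
have cl : c <= l * c by case: (l) l0 => // l' _; rewrite mulSn; lia.
have key u j : N - l * c + j + u * c < N -> s (N - l * c + j + u * c) = s (N - l * c + j).
  elim: u j => [|u IH] j hj; first by rewrite mul0n addn0.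
  rewrite mulSn [c + _]addnC addnA h ?IH //; rewrite ?mulSn in hj; lia.
apply/funext => m; rewrite /loop.
have lc0 : 0 < l * c by lia.
set m1 := m %% (l * c); have hm1 : m1 < l * c by rewrite ltn_mod.
have -> : m %% c = m1 %% c by rewrite /m1 modn_dvdm // dvdn_mull.
rewrite (divn_eq m1 c) [_ * c + _]addnC addnA.
set q := m1 %/ c; set b := m1 %% c.
have hb : b < c by rewrite ltn_mod.
have eqm : q * c + b = m1 by rewrite -divn_eq.
have bmod : (q * c + b) %% c = b by rewrite eqm.
rewrite [b + q * c]addnC bmod key; last by lia.
rewrite -(@key l.-1 b).
  congr s; case: (l) l0 lN cl => //= l' _; rewrite mulSn; lia.
by case: (l) l0 lN cl => //= l' _; rewrite mulSn; lia.
Qed.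

Lemma loop_mul_smaller c l l' : 0 < c -> 0 < l' <= l -> l * c <= N ->
  loop s N (l * c) = loop s N c -> loop s N (l' * c) = loop s N c.
Proof.
move=> c0 hl lN e.
have le1 : l' * c <= l * c by rewrite leq_mul2r; lia.
have h := loop_mul_letters c0 _ lN e.
apply: loop_mul_of_letters => //; [lia|lia|].
by move=> i hi iN; apply: h; lia.
Qed.

End Critical.

(** * Rankings that are compatible with a prefix *)

Definition ranking N (r : nat -> nat) :=
  (forall i, i <= N -> r i <= N) /\
  (forall i j, i <= N -> j <= N -> r i = r j -> i = j).

(** The condition on the first N letters that the order of the shifts imposes
    when letters are compared first and equal letters reverse the order. *)
Definition compatible N (r s : nat -> nat) :=
  forall i j, i < N -> j < N -> r i < r j ->
    s i <= s j /\ (s i = s j -> r j.+1 < r i.+1).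

Lemma ranking_ltNge N r i j : ranking N r -> i <= N -> j <= N -> i != j ->
  (r i < r j) = ~~ (r j < r i).
Proof.
move=> [_ inj] iN jN ij; rewrite -leqNgt ltn_neqAle.
case: eqP => // /(inj _ _ iN jN) e; by rewrite e eqxx in ij.
Qed.

Lemma ranking_neq N r i j : ranking N r -> i <= N -> j <= N -> i != j -> r i != r j.
Proof. by move=> [_ inj] iN jN; apply: contraNneq => /(inj _ _ iN jN) ->. Qed.

Section Spiral.
Variables (N : nat) (r s : nat -> nat).
Hypotheses (rk : ranking N r) (cp : compatible N r s).

Lemma flip_step i j : i < N -> j < N -> s i = s j ->
  (r i < r j) = (r j.+1 < r i.+1).
Proof.
move=> iN jN e; case: (ltngtP (r i) (r j)) => h.
- by rewrite (proj2 (cp iN jN h) e).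
- have := proj2 (cp jN iN h) (esym e) => h'; apply/esym/negbTE; lia.
- have -> : i = j by apply: (proj2 rk) => //; lia.
  by rewrite ltnn.
Qed.

(** Two equal windows of L letters reverse the order L times. *)
Lemma flip_window i j L : i + L <= N -> j + L <= N ->
  (forall u, u < L -> s (i + u) = s (j + u)) ->
  (r i < r j) = if odd L then r (j + L) < r (i + L) else r (i + L) < r (j + L).
Proof.
elim: L i j => [|L IH] i j iN jN h; first by rewrite !addn0.
rewrite flip_step; [|lia|lia|by have := h 0; rewrite !addn0; apply].
rewrite IH; [|lia|lia|by move=> u uL; rewrite !addSnnS h].
by rewrite !addSnnS /=; case: (odd L).
Qed.

Section Abstract.
Variables (y : nat -> nat) (l : nat).
Hypothesis yi : forall a b, a <= l -> b <= l -> y a = y b -> a = b.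

(** In the next lemmas y_a stands for the rank of q^a x.  If the passage from
    q^a x to q^(a+1) x preserves the order, then the orbit is monotone. *)
Lemma monotone_orbit m :
  (forall a b, a < l -> b < l -> (y a.+1 < y b.+1) = (y a < y b)) ->
  0 < m <= l -> (y m < y 0) = (y 1 < y 0).
Proof.
move=> h hm.
have step a : a < l -> (y a.+1 < y a) = (y 1 < y 0).
  by elim: a => // a IH al; rewrite h //; [apply: IH|]; lia.
have neq a : a < l -> y a.+1 <> y a by move=> al /yi; lia.
elim: m hm => // -[|m] IH hm //.
have := IH _; have := step m.+1 _; have := neq m.+1 _; have := @yi 0 m.+1.
case: (ltnP (y 1) (y 0)) => _; lia.
Qed.

Hypothesis flip : forall a b, a < l -> b < l -> (y a.+1 < y b.+1) = (y b < y a).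

Lemma orbit2 a b : a.+1 < l -> b.+1 < l -> (y a.+2 < y b.+2) = (y a < y b).
Proof. by move=> al bl; rewrite !flip //; lia. Qed.

(** If the passage reverses the order, then every second step preserves it, so
    [monotone_orbit] applies to the even part of the orbit. *)
Lemma even_orbit m : 0 < m -> m.*2 <= l -> (y m.*2 < y 0) = (y 2 < y 0).
Proof.
move=> m0 ml.
have step a : a.*2.+2 <= l -> (y a.+1.*2 < y a.*2) = (y 2 < y 0).
  by elim: a => // a IH al; rewrite !doubleS orbit2 -?doubleS; [apply: IH| |]; lia.
elim: m m0 ml => // -[|m] IH hm // ml.
have := IH _ _; have := step m.+1 _; have := @yi m.+2.*2 m.+1.*2.
have := @yi 0 m.+1.*2; have := @yi 0 m.+2.*2.
case: (ltnP (y 2) (y 0)) => _; lia.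
Qed.

(** Either the orbit winds inwards, and then y_(2m+1) lies between y_1 and
    y_(2m), on the side of y_1; or it winds outwards, and y_(2m+1) lies beyond
    y_1. *)
Lemma odd_orbit m : m.*2.+1 <= l -> (y m.*2.+1 < y 0) = (y 1 < y 0).
Proof.
case: m => // m ml.
have e1 := even_orbit (ltn0Sn m) (ltnW ml).
have f1 : (y m.+1.*2.+1 < y m.+1.*2) = (y 1 < y 0).
  have step2 a : a.*2.+1 <= l -> (y a.*2.+1 < y a.*2) = (y 1 < y 0).
    by elim: a => // a IH al; rewrite !doubleS orbit2; [apply: IH| |]; lia.
  exact: step2.
have f2 : (y m.+1.*2.+1 < y 1) = (y 0 < y m.+1.*2) by rewrite flip //; lia.
have := @yi 0 1; have := @yi 0 m.+1.*2; have := @yi 0 m.+1.*2.+1.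
have := @yi 1 m.+1.*2.+1.
case: (ltnP (y 1) (y 0)) => ?; case: (ltnP (y m.+1.*2) (y 0)) => ?; lia.
Qed.

Lemma outward_odd m : y 0 < y 2 -> 0 < m -> m.*2.+1 <= l -> y m.*2.+1 < y 1.
Proof.
move=> h m0 ml; rewrite flip; [|lia|lia].
have := even_orbit m0 (ltnW ml); have := @yi 0 m.*2; lia.
Qed.

Lemma outward_even m : y 0 < y 2 -> 1 < m -> m.*2 <= l -> y 2 < y m.*2.
Proof.
case: m => [|[|m]] // h _ ml; rewrite doubleS orbit2; [|lia|lia].
have := @even_orbit m.+1 _ _; have := @yi 0 m.+1.*2; lia.
Qed.

End Abstract.

Section Orbit.
Variables (c l : nat).
Hypotheses (c0 : 0 < c) (l0 : 0 < l) (lN : l * c <= N)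
  (per : loop s N (l * c) = loop s N c).

(** The rank of q^a x, where q is the block of length c. *)
Definition orbit_rank (a : nat) := r (N - a * c).

Lemma orbit_inj a b : a <= l -> b <= l -> orbit_rank a = orbit_rank b -> a = b.
Proof.
move=> al bl /(proj2 rk).
have la : a * c <= l * c by rewrite leq_mul2r al orbT.
have lb : b * c <= l * c by rewrite leq_mul2r bl orbT.
move=> h; have : N - a * c = N - b * c by apply: h; lia.
move=> e; have : a * c = b * c by lia.
by move/eqP; rewrite eqn_pmul2r // => /eqP.
Qed.

Lemma orbit_letters a u : 0 < a <= l -> u < c ->
  s (N - a * c + u) = s (N - c + u).
Proof.
case: a => // a; elim: a => [|a IH] al uc; first by rewrite mul1n.
have la : a.+2 * c <= l * c by rewrite leq_mul2r; lia.
rewrite -IH //; last by lia.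
have e2 : a.+2 * c = c + (c + a * c) by rewrite !mulSn.
have e1 : a.+1 * c = c + a * c by rewrite mulSn.
rewrite -(loop_mul_letters c0 l0 lN per (i := N - a.+2 * c + u)); last 2 first.
- lia.
- lia.
by congr s; lia.
Qed.

Lemma orbit_step a b : a < l -> b < l ->
  (orbit_rank a.+1 < orbit_rank b.+1) = if odd c then orbit_rank b < orbit_rank a else orbit_rank a < orbit_rank b.
Proof.
move=> al bl; rewrite /orbit_rank.
have la : a.+1 * c <= l * c by rewrite leq_mul2r; lia.
have lb : b.+1 * c <= l * c by rewrite leq_mul2r; lia.
rewrite (@flip_window _ _ c).
- have -> : N - a.+1 * c + c = N - a * c by rewrite mulSn in la *; lia.
  by have -> : N - b.+1 * c + c = N - b * c by rewrite mulSn in lb *; lia.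
- rewrite mulSn in la *; lia.
- rewrite mulSn in lb *; lia.
- by move=> u uc; rewrite !orbit_letters; lia.
Qed.

Lemma orbit_same_side m : 0 < m <= l -> ~~ odd c || odd m -> (orbit_rank m < orbit_rank 0) = (orbit_rank 1 < orbit_rank 0).
Proof.
move=> ml; case: (boolP (odd c)) => oc /= om.
  have fl a b : a < l -> b < l -> (orbit_rank a.+1 < orbit_rank b.+1) = (orbit_rank b < orbit_rank a).
    by move=> al bl; rewrite orbit_step // oc.
  have <- : (m./2).*2.+1 = m by lia.
  by apply: (odd_orbit orbit_inj fl); lia.
apply: (monotone_orbit orbit_inj) => // a b al bl.
by rewrite orbit_step // (negbTE oc).
Qed.

Lemma orbit_same_side2 m : 0 < m <= l -> odd c -> ~~ odd m -> (orbit_rank m < orbit_rank 0) = (orbit_rank 2 < orbit_rank 0).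
Proof.
move=> ml oc om.
have fl a b : a < l -> b < l -> (orbit_rank a.+1 < orbit_rank b.+1) = (orbit_rank b < orbit_rank a).
  by move=> al bl; rewrite orbit_step // oc.
have <- : (m./2).*2 = m by lia.
by apply: (even_orbit orbit_inj fl); lia.
Qed.

Lemma orbit_outward m : odd c -> 0 < m <= l -> orbit_rank 0 < orbit_rank 2 -> m != 1 -> m != 2 ->
  orbit_rank m < orbit_rank 1 \/ orbit_rank 2 < orbit_rank m.
Proof.
move=> oc ml h m1 m2.
have fl a b : a < l -> b < l -> (orbit_rank a.+1 < orbit_rank b.+1) = (orbit_rank b < orbit_rank a).
  by move=> al bl; rewrite orbit_step // oc.
case om : (odd m).
  left; have <- : (m./2).*2.+1 = m by lia.
  by apply: (outward_odd orbit_inj fl); lia.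
right; have <- : (m./2).*2 = m by lia.
by apply: (outward_even orbit_inj fl); lia.
Qed.

End Orbit.

(** P comes immediately before or after N in the ranking, so that all other
    indices compare with N as with P. *)
Definition adjacent P := P < N /\ (forall j, j < N -> j != P -> (r j < r N) = (r j < r P)).

Lemma adjacent_exists : 0 < N ->
  exists P, adjacent P /\ ((exists2 j, j < N & r j < r N) -> r P < r N).
Proof.
move=> N0; have neN j : j < N -> r j != r N.
  by move=> jN; apply: (ranking_neq rk); lia.
case: (pselect (exists2 j, j < N & r j < r N)) => [[j0 j0N j0r]|nex].
  pose Q (i : 'I_N) := r i < r N.
  case: (@arg_maxnP _ (Ordinal j0N) Q (fun i => r i)) => // P QP maxP.
  exists P; split=> //; split=> // j jN jP.
  have := maxP (Ordinal jN); rewrite /Q /= => mx.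
  have := ranking_neq rk (ltnW jN) (ltnW (ltn_ord P)) jP.
  move: QP mx; rewrite /Q; case: (ltnP (r j) (r N)) => // h1 h2 => [/(_ isT)|_]; lia.
case: (@arg_minnP _ (Ordinal N0) predT (fun i => r i)) => // P _ minP.
exists P; split; last by move=> ex; case: nex.
split=> // j jN jP; have := minP (Ordinal jN) isT => /= mn.
have h : ~ r j < r N by move=> h; apply: nex; exists j.
have := ranking_neq rk (ltnW jN) (ltnW (ltn_ord P)) jP.
by move: h mn; case: (ltnP (r j) (r N)) => // h1 _; lia.
Qed.

(** Since N and P compare alike with the other indices, one may replace N by P
    whenever it appears.  This gives an infinite word for which the shifts are
    at least weakly in the order of r: take as tail the repetition of the
    letters from P to N - 1. *)
Lemma adjacent_loop_weak_order P : adjacent P ->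
  let w := prepend s N (loop s N (N - P)) in
  forall i j, i <= N -> j <= N -> r i <= r j -> ~ alt_lt (tail w j) (tail w i).
Proof.
move=> [PN adj] w.
have wNP : tail w N = tail w P.
  rewrite tail_prepend -[in RHS](subKn (ltnW PN)); apply/esym/tail_fix => //; lia.
have ws i : i < N -> w i = s i by exact: prepend_prefix.
have neN j : j < N -> r j != r N.
  by move=> jN; apply: (ranking_neq rk); lia.
(* An index N is replaced by P, which does not change the word. *)
have norm i j : i <= N -> j <= N -> r i <= r j -> exists i1 j1,
    [/\ i1 < N, j1 < N, tail w i = tail w i1, tail w j = tail w j1 & r i1 <= r j1].
  case: (ltngtP i N) => // [iN|->] _; case: (ltngtP j N) => // [jN|->] _ rij.
  - by exists i, j.
  - exists i, P; split=> //; case: (eqVneq i P) => [->//|ne].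
    by have := adj i iN ne; have := neN i iN; lia.
  - exists P, j; split=> //; case: (eqVneq j P) => [->//|ne].
    have := adj j jN ne; have := neN j jN.
    by have := ranking_neq rk (ltnW jN) (ltnW PN) ne; lia.
  - by exists P, P.
have key m i j : i <= N -> j <= N -> r i <= r j ->
    (forall u, u < m -> w (i + u) = w (j + u)) ->
    if odd m then w (j + m) <= w (i + m) else w (i + m) <= w (j + m).
  elim: m i j => [|m IH] i j iN jN rij eqm;
    have [i1 [j1 [i1N j1N ei ej rij1]]] := norm i j iN jN rij.
    have wi : w i = w i1 by have := congr1 (@^~ 0) ei; rewrite /tail !addn0.
    have wj : w j = w j1 by have := congr1 (@^~ 0) ej; rewrite /tail !addn0.
    rewrite /= !addn0 wi wj !ws //; case: (eqVneq i1 j1) => [->//|ne].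
    have := ranking_neq rk (ltnW i1N) (ltnW j1N) ne.
    move: rij1; rewrite leq_eqVlt; case: eqP => //= _ h _.
    by case: (cp i1N j1N h).
  have wi u : w (i + u) = w (i1 + u) by have := congr1 (@^~ u) ei.
  have wj u : w (j + u) = w (j1 + u) by have := congr1 (@^~ u) ej.
  rewrite wi wj.
  case: (eqVneq i1 j1) => [->|ne]; first by case: ifP.
  have lt1 : r i1 < r j1.
    by rewrite ltn_neqAle rij1 andbT; apply: (ranking_neq rk) => //; exact: ltnW.
  have e0 : s i1 = s j1.
    by have := eqm 0 isT; rewrite wi wj !addn0 !ws.
  have h := proj2 (cp i1N j1N lt1) e0.
  have := IH j1.+1 i1.+1 j1N i1N (ltnW h) _.
  rewrite !addSnnS /=; case: (odd m) => /= H; apply: H => u um;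
    by rewrite !addSnnS -wi -wj eqm.
move=> i j iN jN rij [m [eqm dm]].
have := key m i j iN jN rij (fun u um => esym (eqm u um)).
by move: dm; rewrite /tail; case: ifP => _; lia.
Qed.

End Spiral.

(** * The rankings compatible with a given prefix *)

(** The rank of i is the number of elements below it. *)
Lemma rank_of_order N (M : nat -> nat -> bool) :
  (forall i, i <= N -> M i i = false) ->
  (forall i j l, i <= N -> j <= N -> l <= N -> M i j -> M j l -> M i l) ->
  (forall i j, i <= N -> j <= N -> i != j -> M i j || M j i) ->
  exists r, ranking N r /\ forall i j, i <= N -> j <= N -> (r i < r j) = M i j.
Proof.
move=> irr tr tot.
pose D i := [set j : 'I_N.+1 | M j i].
have lt i j : i <= N -> j <= N -> M i j -> #|D i| < #|D j|.
  move=> iN jN Mij; apply: proper_card; apply/properP; split.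
    apply/subsetP => l; rewrite !inE => Mli; apply: tr Mij => //.
    by rewrite -ltnS ltn_ord.
  have iN' : i < N.+1 by rewrite ltnS.
  by exists (Ordinal iN'); rewrite !inE //= irr.
have ltE i j : i <= N -> j <= N -> (#|D i| < #|D j|) = M i j.
  move=> iN jN; case: (eqVneq i j) => [->|ne]; first by rewrite ltnn irr.
  case Mij: (M i j); first exact: lt.
  have := tot i j iN jN ne; rewrite Mij /= => /(lt _ _ jN iN).
  by case: ltngtP.
exists (fun i => #|D i|); split=> //; split=> [i iN|i j iN jN e].
  suff : #|D i| < #|'I_N.+1| by rewrite card_ord ltnS.
    rewrite -cardsT; apply: proper_card; rewrite properT.
    have iN' : i < N.+1 by rewrite ltnS.
    apply/eqP => /setP /(_ (Ordinal iN')); rewrite !inE /= irr //.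
apply/eqP; apply: contraT => ne; have := tot i j iN jN ne.
by rewrite -!ltE // e ltnn.
Qed.

(** The order of two indices i and j can be read from the letters unless the
    letters agree until one index reaches N; so it is determined by the
    comparisons with N. *)
Lemma compatible_unique N r r' s : ranking N r -> ranking N r' ->
  compatible N r s -> compatible N r' s ->
  (forall t, 0 < t <= N -> (r (N - t) < r N) = (r' (N - t) < r' N)) ->
  forall i j, i <= N -> j <= N -> (r i < r j) = (r' i < r' j).
Proof.
move=> rk rk' cp cp' eT.
have eT' i : i < N -> (r i < r N) = (r' i < r' N).
  by move=> iN; have := eT (N - i); rewrite (subKn (ltnW iN)); apply; lia.
have key n i j : i <= N -> j <= N -> (N - i) + (N - j) < n -> (r i < r j) = (r' i < r' j).
  elim: n i j => // n IH i j iN jN hn.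
  case: (eqVneq i j) => [->|ne]; first by rewrite !ltnn.
  case: (ltngtP i N) iN => // [iN|eN] _; last first.
    have jN' : j < N by lia.
    by rewrite eN (ranking_ltNge rk) ?(ranking_ltNge rk' (i := N)) ?eT'; lia.
  case: (ltngtP j N) jN => // [jN|eN] _; last by rewrite eN eT'.
  case: (ltngtP (s i) (s j)) => sij.
  - have -> : r i < r j.
      rewrite (ranking_ltNge rk (ltnW iN) (ltnW jN) ne); apply/negP => /(cp _ _ jN iN)[]; lia.
    apply/esym; rewrite (ranking_ltNge rk' (ltnW iN) (ltnW jN) ne); apply/negP => /(cp' _ _ jN iN)[]; lia.
  - have -> : (r i < r j) = false by apply/negP => /(cp _ _ iN jN)[]; lia.
    by apply/esym/negP => /(cp' _ _ iN jN)[]; lia.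
  - rewrite (flip_step rk cp) // (flip_step rk' cp') //; apply: IH => //; lia.
by move=> i j iN jN; apply: (key (N + N).+1) => //; lia.
Qed.

(** Prefixing s to a tail x ranks the shifts of s x; equal shifts are separated
    by a tie-breaking function delta that is reversed by the shift, as the order
    of words is.  This realizes the rankings whose tail is infinitely close to a
    point q^oo. *)
Lemma lexicographic_ranking s N x (delta : nat -> nat) :
  (forall i j, i < N -> j < N -> delta i < delta j -> delta j.+1 < delta i.+1) ->
  (forall i j, i <= N -> j <= N -> delta i = delta j -> i = j) ->
  let w := prepend s N x in
  exists r, [/\ ranking N r, compatible N r s,
    (forall i j, i <= N -> j <= N -> r i < r j <->
       alt_lt (tail w i) (tail w j) \/ (tail w i = tail w j /\ delta i < delta j)) &
    (forall t, 0 < t <= N ->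
       r (N - t) < r N <-> alt_lt (loop s N t) x \/ (loop s N t = x /\ delta (N - t) < delta N))].
Proof.
move=> fl inj w.
pose M i j := `[< alt_lt (tail w i) (tail w j) \/ (tail w i = tail w j /\ delta i < delta j) >].
have [||| r [rk rM]] := @rank_of_order N M.
- move=> i iN; apply/asboolP => -[/alt_lt_irr//|[_]]; by rewrite ltnn.
- move=> i j l iN jN lN /asboolP h1 /asboolP h2; apply/asboolP.
  case: h1 h2 => [h1|[e1 d1]] [h2|[e2 d2]].
  + by left; apply: alt_lt_trans h2.
  + by left; rewrite -e2.
  + by left; rewrite e1.
  + by right; split; [rewrite e1|lia].
- move=> i j iN jN ne; apply/orP.
  case: (alt_lt_total (tail w i) (tail w j)) => [h|e|h].
  + by left; apply/asboolP; left.
  + case: (ltngtP (delta i) (delta j)) => [d|d|/(inj _ _ iN jN) e'].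
    * by left; apply/asboolP; right.
    * by right; apply/asboolP; right.
    * by rewrite e' eqxx in ne.
  + by right; apply/asboolP; left.
have rM' i j : i <= N -> j <= N -> r i < r j <->
       alt_lt (tail w i) (tail w j) \/ (tail w i = tail w j /\ delta i < delta j).
  by move=> iN jN; rewrite rM //; split=> /asboolP.
exists r; split=> //.
  move=> i j iN jN /(rM' _ _ (ltnW iN) (ltnW jN)).
  rewrite tail_cons tail_eq_cons /w !prepend_prefix // -/w => h; split.
    by case: h => [[|[]]|[[]]]; lia.
  move=> es; rewrite es ltnn in h.
  apply/rM' => //; case: h => [[//|[_ h]]|[[_ e] d]]; [by left|right; split=> //].
  exact: fl.
move=> t ht; rewrite rM' //; [|lia].
rewrite /w tail_prepend tail_gt //.
split=> -[h|[e d]]; [by left|right|by left|right]; split=> //.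
  by apply/esym/(tail_fix _ _ ht).
by apply/tail_fix.
Qed.

(** The shifts q x and q q x by N - c and N - 2 c are on both sides of x, so
    that the orbit of x winds outwards around q^oo.  For real words it winds
    inwards, as prefixing q is a contraction towards q^oo that reverses the
    order. *)
Definition spiral N r s c :=
  [/\ odd c, 2 * c <= N, primitive_suffix s N c, loop s N (2 * c) = loop s N c &
     r (N - c) < r N < r (N - 2 * c)].
Definition spiral_rev N r s c :=
  [/\ odd c, 2 * c <= N, primitive_suffix s N c, loop s N (2 * c) = loop s N c &
     r (N - 2 * c) < r N < r (N - c)].
Definition spiral_free N r s := forall c, ~ spiral N r s c /\ ~ spiral_rev N r s c.

(** A tie-breaking function for tails infinitely close above q^oo: it alternates
    around the middle, with amplitude increasing in i, so the orbit of N winds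
    inwards. *)
Definition inward N i := if odd (N - i) then N - i else N.+1 + i.
(** The same with decreasing amplitude: the orbit of N winds outwards. *)
Definition outward N i := if odd (N - i) then i else N.+1 + (N.+1 - i).

Lemma inward_flip N i j : i < N -> j < N ->
  inward N i < inward N j -> inward N j.+1 < inward N i.+1.
Proof.
rewrite /inward => iN jN.
have -> : odd (N - i) = ~~ odd (N - i.+1) by rewrite -(subnSK iN) /=.
have -> : odd (N - j) = ~~ odd (N - j.+1) by rewrite -(subnSK jN) /=.
by do 2 case: odd => /=; lia.
Qed.
Lemma inward_inj N i j : i <= N -> j <= N -> inward N i = inward N j -> i = j.
Proof. by rewrite /inward; do 2 case: odd => /=; lia. Qed.
Lemma inward_top N i : i < N -> inward N i < inward N N.
Proof. by rewrite /inward subnn /=; case: odd => /=; lia. Qed.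

Lemma outward_flip N i j : i < N -> j < N ->
  outward N i < outward N j -> outward N j.+1 < outward N i.+1.
Proof.
rewrite /outward => iN jN.
have -> : odd (N - i) = ~~ odd (N - i.+1) by rewrite -(subnSK iN) /=.
have -> : odd (N - j) = ~~ odd (N - j.+1) by rewrite -(subnSK jN) /=.
by do 2 case: odd => /=; lia.
Qed.
Lemma outward_inj N i j : i <= N -> j <= N -> outward N i = outward N j -> i = j.
Proof. by rewrite /outward; do 2 case: odd => /=; lia. Qed.

Section Cut.
Variables (N : nat) (r s : nat -> nat).
Hypotheses (rk : ranking N r) (cp : compatible N r s).

(** The side of N on which the shift by N - t lies when q_t = q^l: it is that of
    the first or of the second power of q.  The last clause says that in an
    outward orbit no other power comes between the first two. *)
Lemma orbit_side t c : 0 < c <= N -> 0 < t <= N -> primitive_suffix s N c -> loop s N t = loop s N c ->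
  exists2 l, t = l * c &
    [/\ 0 < l,
     ~~ odd c || odd l -> (r (N - t) < r N) = (r (N - c) < r N),
     odd c -> ~~ odd l -> [/\ 2 * c <= N, loop s N (2 * c) = loop s N c &
       (r (N - t) < r N) = (r (N - 2 * c) < r N)] &
     odd c -> 2 * c <= N -> loop s N (2 * c) = loop s N c ->
       r N < r (N - 2 * c) -> l != 1 -> l != 2 ->
       r (N - t) < r (N - c) \/ r (N - 2 * c) < r (N - t)].
Proof.
move=> hc ht pc e; have /dvdnP[l tl] := primitive_suffix_dvd hc ht pc e.
exists l => //; have l0 : 0 < l by case: l tl => //; lia.
have c0 : 0 < c by lia.
rewrite tl in ht e *; have lN : l * c <= N by lia.
have o0 : orbit_rank N r c 0 = r N by rewrite /orbit_rank mul0n subn0.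
have o1 : orbit_rank N r c 1 = r (N - c) by rewrite /orbit_rank mul1n.
have hl : 0 < l <= l by rewrite l0 leqnn.
split=> //.
- by move=> h; have := orbit_same_side rk cp c0 l0 lN e hl h; rewrite o0 o1.
- move=> oc ol; have l2 : 2 <= l by case: (l) l0 ol => // -[].
  have lt : 2 * c <= l * c by rewrite leq_mul2r l2 orbT.
  split; first lia.
    exact: (loop_mul_smaller (l := l)).
  by have := orbit_same_side2 rk cp c0 l0 lN e hl oc ol; rewrite o0.
- move=> oc _ _ h l1 l2.
  by have := @orbit_outward _ _ _ rk cp _ _ c0 l0 lN e _ oc hl; rewrite o0 o1; apply.
Qed.

(** Without spirals the second power of q lies on the same side as the first
    one, so the side depends only on the point q_t^oo. *)
Lemma same_side t t' : spiral_free N r s -> 0 < t <= N -> 0 < t' <= N ->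
  loop s N t = loop s N t' -> (r (N - t) < r N) = (r (N - t') < r N).
Proof.
move=> no ht ht' e; have [c [hc pc ec]] := root_exists s ht.
have hcN : 0 < c <= N by lia.
have key u : 0 < u <= N -> loop s N u = loop s N c -> (r (N - u) < r N) = (r (N - c) < r N).
  move=> hu eu; have [l ul [l0 h1 h2 _]] := orbit_side hcN hu pc eu.
  case: (boolP (~~ odd c || odd l)) => [/h1//|].
  rewrite negb_or negbK => /andP[oc ol]; case: (h2 oc ol) => c2 e2 ->.
  case: (no c) => n1 n2.
  have ne1 : r (N - c) != r N by apply: (ranking_neq rk); lia.
  have ne2 : r (N - 2 * c) != r N by apply: (ranking_neq rk); lia.
  case: (ltnP (r (N - 2 * c)) (r N)) => h; case: (ltnP (r (N - c)) (r N)) => h' //.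
    by case: n2; split=> //; lia.
  by case: n1; split=> //; lia.
by rewrite !key // -e.
Qed.

(** The tail chosen by [adjacent_loop_weak_order] is squeezed between q^oo and
    (q q)^oo, which are equal. *)
Lemma spiral_cut c : spiral N r s c -> exists P, adjacent N r P /\ loop s N (N - P) = loop s N c.
Proof.
case=> oc c2 pc e2 /andP[h1 h2].
have c0 : 0 < c by case: c oc {c2 pc e2 h1 h2}.
have [|P [adP predP]] := adjacent_exists rk; first lia.
exists P; split=> //.
have up : ~ alt_lt (loop s N (N - P)) (loop s N c).
  rewrite -tail_lt; last lia.
  rewrite -[X in alt_lt X _](tail_prepend s N).
  by apply: (adjacent_loop_weak_order rk cp adP); lia.
have dn : ~ alt_lt (loop s N c) (loop s N (N - P)).
  rewrite -e2 -tail_gt; last lia.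
  rewrite -[X in alt_lt _ X](tail_prepend s N).
  by apply: (adjacent_loop_weak_order rk cp adP); lia.
by case: (alt_lt_total (loop s N (N - P)) (loop s N c)).
Qed.

Lemma spiral_side c : spiral N r s c -> forall t, 0 < t <= N ->
  r (N - t) < r N <-> alt_lt (loop s N t) (loop s N c) \/ (loop s N t = loop s N c /\ odd t).
Proof.
move=> oc t ht; have [P [adP eP]] := spiral_cut oc.
case: oc => oc c2 pc e2 /andP[h1 h2].
have c0 : 0 < c by case: c oc {c2 pc e2 h1 h2 eP}.
have up : r (N - t) < r N -> ~ alt_lt (loop s N c) (loop s N t).
  move=> h; rewrite -eP -tail_lt // -[X in alt_lt X _](tail_prepend s N).
  by apply: (adjacent_loop_weak_order rk cp adP); lia.
have dn : r N < r (N - t) -> ~ alt_lt (loop s N t) (loop s N c).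
  move=> h; rewrite -eP -tail_gt // -[X in alt_lt _ X](tail_prepend s N).
  by apply: (adjacent_loop_weak_order rk cp adP); lia.
have ne : r (N - t) != r N by apply: (ranking_neq rk); lia.
case: (alt_lt_total (loop s N t) (loop s N c)) => [g|e|g].
- by split=> [_|_]; [left|case: ltngtP ne => // /dn].
- have hc : 0 < c <= N by lia.
  have [l tl [l0 k1 k2 _]] := orbit_side hc ht pc e.
  have ot : odd t = odd l by rewrite tl oddM oc andbT.
  rewrite ot; case ol: (odd l).
    by rewrite k1 ?ol ?orbT // h1; split=> // _; right.
  case: (k2 oc (negbT ol)) => _ _ ->; split=> [|[|[]]] //; first by lia.
  by rewrite e => /alt_lt_irr.
- split=> [/up//|[g'|[e _]]]; first by case: (alt_lt_asym g).
  by move: g; rewrite e => /alt_lt_irr.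
Qed.

Hypothesis N0 : 0 < N.

(** The weakly ordered word has a tail that separates weakly the points of the
    shifts below N from the points of the shifts above N. *)
Lemma cut_point : exists P, let x := loop s N (N - P) in
  [/\ P < N, (forall t, 0 < t <= N -> r (N - t) < r N -> ~ alt_lt x (loop s N t)),
     (forall t, 0 < t <= N -> r N < r (N - t) -> ~ alt_lt (loop s N t) x) &
     (exists2 j, j < N & r j < r N) -> r P < r N].
Proof.
have [P [adP predP]] := adjacent_exists rk N0.
exists P => x; split=> //; first by case: adP.
- move=> t ht h; rewrite -tail_lt // -[X in alt_lt X _](tail_prepend s N).
  by apply: (adjacent_loop_weak_order rk cp adP); lia.
- move=> t ht h; rewrite -tail_gt // -[X in alt_lt _ X](tail_prepend s N).
  by apply: (adjacent_loop_weak_order rk cp adP); lia.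
Qed.

(** Without spirals a compatible ranking places N either below all other shifts,
    or infinitely close above one of the points q_t^oo: take the point of the
    predecessor of N. *)
Lemma spiral_free_classify : spiral_free N r s ->
  (forall t, 0 < t <= N -> ~ r (N - t) < r N) \/
  (exists c, [/\ 0 < c <= N, primitive_suffix s N c &
    forall t, 0 < t <= N -> r (N - t) < r N <-> ~ alt_lt (loop s N c) (loop s N t)]).
Proof.
move=> no; case: (pselect (exists2 j, j < N & r j < r N)) => [ex|nex]; last first.
  by left=> t ht h; apply: nex; exists (N - t) => //; lia.
right; have [P [PN up dn predP]] := cut_point.
have hP : 0 < N - P <= N by lia.
have [c [hc pc ec]] := root_exists s hP; exists c; split=> //; first lia.
move=> t ht; rewrite ec; split; first exact: up.
move=> h; case: (ltnP (r (N - t)) (r N)) => // h'.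
have ne : r (N - t) != r N by apply: (ranking_neq rk); lia.
have h2 := dn t ht; case: (alt_lt_total (loop s N (N - P)) (loop s N t)) => // [e|g].
  by have := same_side no ht hP (esym e); rewrite subKn ?predP //; lia.
by case: h2 => //; lia.
Qed.

End Cut.

Lemma spiral_free_of_sides N r s :
  (forall t t', 0 < t <= N -> 0 < t' <= N -> loop s N t = loop s N t' ->
     (r (N - t) < r N) = (r (N - t') < r N)) -> spiral_free N r s.
Proof.
move=> h c; split=> -[oc c2 pc e2]; have c0 : 0 < c by case: (c) oc.
  by have := h (2 * c) c _ _ e2; lia.
by have := h (2 * c) c _ _ e2; lia.
Qed.

(** The letter k is outside the alphabet, so that the tail 0 k 0 k ... is
    smaller than all q_t^oo even if one of them is the least word over the
    alphabet. *)
Lemma exists_bottom N s k : (forall i, s i < k) ->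
  exists r, [/\ ranking N r, compatible N r s, spiral_free N r s &
    forall t, 0 < t <= N -> ~ r (N - t) < r N].
Proof.
move=> sk; pose x := fun m => if odd m then k else 0.
have [r [rk cp _ T]] := @lexicographic_ranking s N x _ (@inward_flip N) (@inward_inj N).
have T' t : 0 < t <= N -> ~ r (N - t) < r N.
  move=> ht; rewrite T // => h.
  have lt : alt_lt x (loop s N t).
    rewrite alt_lt_cons; case: (posnP (loop s N t 0)) => [->|]; last by left.
    by right; split=> //; rewrite alt_lt_cons; left; rewrite /tail /= /loop.
  case: h => [/(alt_lt_asym lt)//|[e _]]; by move: lt; rewrite e => /alt_lt_irr.
exists r; split=> //; apply: spiral_free_of_sides => t t' ht ht' _.
by rewrite !(introF idP (T' _ _)).
Qed.

Lemma exists_above N s c : 0 < c <= N ->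
  exists r, [/\ ranking N r, compatible N r s, spiral_free N r s &
    forall t, 0 < t <= N -> r (N - t) < r N <-> ~ alt_lt (loop s N c) (loop s N t)].
Proof.
move=> hc; have [r [rk cp _ T]] := @lexicographic_ranking s N (loop s N c) _ (@inward_flip N) (@inward_inj N).
have T' t : 0 < t <= N -> r (N - t) < r N <-> ~ alt_lt (loop s N c) (loop s N t).
  move=> ht; rewrite T //; split=> [[h /(alt_lt_asym h)//|[-> _] /alt_lt_irr//]|h].
  case: (alt_lt_total (loop s N t) (loop s N c)) => // [g|e]; first by left.
  by right; split=> //; apply: inward_top; lia.
exists r; split=> //; apply: spiral_free_of_sides => t t' ht ht' e.
by apply/idP/idP => /T' h; apply/T' => //; move: h; rewrite e; apply.
Qed.

Lemma exists_spiral N s c : odd c -> 2 * c <= N -> primitive_suffix s N c ->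
  loop s N (2 * c) = loop s N c ->
  exists r, [/\ ranking N r, compatible N r s & spiral N r s c].
Proof.
move=> oc c2 pc e2.
have [r [rk cp _ T]] := @lexicographic_ranking s N (loop s N c) _ (@outward_flip N) (@outward_inj N).
exists r; split=> //; split=> //; have c0 : 0 < c by case: (c) oc.
have oNN : outward N N = N.+2 by rewrite /outward subnn /=; lia.
apply/andP; split.
  rewrite T; last lia.
  right; split=> //; rewrite oNN /outward subKn ?oc; lia.
have ne : r (N - 2 * c) != r N by apply: (ranking_neq rk); lia.
case: ltngtP ne => // + _.
rewrite T; last lia.
rewrite e2 => -[/alt_lt_irr//|[_]]; rewrite oNN /outward subKn // oddM /=; lia.
Qed.

(** * Spirals *)

Section SpiralGap.
Variables (N : nat) (r s : nat -> nat).
Hypotheses (rk : ranking N r) (cp : compatible N r s).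

Lemma spiral_squeeze c : spiral N r s c -> exists w,
  [/\ tail w N = loop s N c, tail w (N - c) = loop s N c,
      tail w (N - 2 * c) = loop s N c, (forall i, i < N -> w i = s i) &
      forall i j, i <= N -> j <= N -> r i <= r j -> ~ alt_lt (tail w j) (tail w i)].
Proof.
move=> oc; have [P [adP eP]] := spiral_cut rk cp oc.
case: oc => oc c2 pc e2 h.
have c0 : 0 < c by case: (c) oc.
exists (prepend s N (loop s N (N - P))); split.
- by rewrite tail_prepend.
- by rewrite -[RHS]eP; apply/tail_fix; [lia|].
- by rewrite -[RHS]eP; apply/tail_fix; [lia|rewrite e2].
- by move=> i; apply: prepend_prefix.
- exact: (adjacent_loop_weak_order rk cp adP).
Qed.

(** Only N lies between q x and q q x: a shift in between is squeezed to q^oo,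
    so it is some q^l x, and an outward orbit has no such element in the
    interval. *)
Lemma spiral_gap c : spiral N r s c -> forall j, j < N ->
  ~~ (r (N - c) < r j < r (N - 2 * c)).
Proof.
move=> oc j jN; apply/negP => /andP[h1 h2].
have [w [wN wc w2c ws wk]] := spiral_squeeze oc.
case: oc => oc c2 pc e2 /andP[h3 h4].
have c0 : 0 < c by case: (c) oc.
have wj : tail w j = loop s N c.
  have a1 : ~ alt_lt (tail w j) (loop s N c) by rewrite -wc; apply: wk; lia.
  have a2 : ~ alt_lt (loop s N c) (tail w j) by rewrite -w2c; apply: wk; lia.
  by case: (alt_lt_total (tail w j) (loop s N c)).
have ht : 0 < N - j <= N by lia.
have hc : 0 < c <= N by lia.
have wE : w = prepend s N (loop s N c).
  apply/funext => i; rewrite /prepend; case: ltnP => [/ws//|Ni].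
  by rewrite -wN /tail subnKC.
have e : loop s N (N - j) = loop s N c.
  apply/esym/tail_fix => //; rewrite -wE subKn //; exact: ltnW.
have [l tl [l0 _ _ h]] := orbit_side rk cp hc ht pc e.
have := h oc c2 e2 h4; rewrite subKn; last exact: ltnW.
case: (eqVneq l 1) => [l1|_].
  have ej : j = N - c by rewrite l1 in tl; lia.
  by move: h1; rewrite ej ltnn.
case: (eqVneq l 2) => [l2|_].
  have ej : j = N - 2 * c by rewrite l2 in tl; lia.
  by move: h2; rewrite ej ltnn.
by case/(_ isT isT); lia.
Qed.

(** For i > 0 the shifts of q x and q q x by i letters are adjacent.  A shift
    strictly in between is squeezed to the same infinite word as these two; by
    primitivity it starts with the same c - i letters and leads to a power of q
    between q x and x, which [spiral_gap] excludes. *)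
Lemma spiral_pairs c i : spiral N r s c -> i < c -> forall j, j < N ->
  ~~ (r (N - 2 * c + i) < r j < r (N - c + i)) /\
  ~~ (r (N - c + i) < r j < r (N - 2 * c + i)).
Proof.
move=> oc ic j jN.
have gap := spiral_gap oc.
have [w [wN wc w2c ws wk]] := spiral_squeeze oc.
case: (oc) => oddc c2 pc e2 /andP[h3 h4].
case: (posnP i) => [->|i0]; first by rewrite !addn0; have := gap j jN; lia.
have wi1 : tail w (N - c + i) = tail (loop s N c) i by rewrite -tail_tail wc.
have wi2 : tail w (N - 2 * c + i) = tail (loop s N c) i by rewrite -tail_tail w2c.
suff key : j != N - c + i -> j != N - 2 * c + i ->
    ~~ ((r (N - 2 * c + i) < r j) (+) (r (N - c + i) < r j)).
  split; apply/negP => /andP[h1 h2].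
    have n1 : j != N - c + i by apply: contraTneq h2 => ->; rewrite ltnn.
    have n2 : j != N - 2 * c + i by apply: contraTneq h1 => ->; rewrite ltnn.
    by have := key n1 n2; rewrite h1 ltnNge (ltnW h2).
  have n1 : j != N - c + i by apply: contraTneq h1 => ->; rewrite ltnn.
  have n2 : j != N - 2 * c + i by apply: contraTneq h2 => ->; rewrite ltnn.
  by have := key n1 n2; rewrite h1 ltnNge (ltnW h2).
move=> jn1 jn2; apply/negP => btw.
have wj : tail w j = tail (loop s N c) i.
  case: (ltnP (r (N - 2 * c + i)) (r j)) btw => b1; case: (ltnP (r (N - c + i)) (r j)) => b2 // _.
    have a1 : ~ alt_lt (tail w j) (tail (loop s N c) i) by rewrite -wi2; apply: wk; lia.
    have a2 : ~ alt_lt (tail (loop s N c) i) (tail w j) by rewrite -wi1; apply: wk; lia.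
    by case: (alt_lt_total (tail w j) (tail (loop s N c) i)).
  have a1 : ~ alt_lt (tail w j) (tail (loop s N c) i) by rewrite -wi1; apply: wk; lia.
  have a2 : ~ alt_lt (tail (loop s N c) i) (tail w j) by rewrite -wi2; apply: wk; lia.
  by case: (alt_lt_total (tail w j) (tail (loop s N c) i)).
have hc : 0 < c <= N by lia.
have dv : c %| i + (N - j).
  apply: (primitive_suffix_shift hc pc); rewrite -tail_tail -wj tail_tail subnKC //; exact: ltnW.
case/dvdnP: dv => l hl; have l0 : 0 < l by case: l hl => //; lia.
have [l' ll] : exists l', l = l'.+1 by exists l.-1; lia.
(* After c - i letters, j leads to the shift q^l' x. *)
have hl' : i + (N - j) = c + l' * c by rewrite hl ll mulSn.
have let1 u : u < c - i -> s (j + u) = loop s N c (i + u).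
  by move=> uc; rewrite -ws; [have := congr1 (@^~ u) wj|lia].
have let2 u : u < c - i -> s (N - c + i + u) = loop s N c (i + u).
  by move=> uc; rewrite -ws; [have := congr1 (@^~ u) wi1|lia].
have let3 u : u < c - i -> s (N - 2 * c + i + u) = loop s N c (i + u).
  by move=> uc; rewrite -ws; [have := congr1 (@^~ u) wi2|lia].
have lN : l' * c <= N by lia.
have w1 := @flip_window _ _ _ rk cp (N - 2 * c + i) j (c - i).
have w2 := @flip_window _ _ _ rk cp (N - c + i) j (c - i).
rewrite w1 in btw; [|lia|lia|by move=> u uc; rewrite let3 ?let1].
rewrite w2 in btw; [|lia|lia|by move=> u uc; rewrite let2 ?let1].
have eJ : j + (c - i) = N - l' * c by lia.
have e3 : N - 2 * c + i + (c - i) = N - c by lia.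
have e4 : N - c + i + (c - i) = N by lia.
rewrite eJ e3 e4 in btw.
case: (posnP l') => [l'0|l'0].
  by case/eqP: jn1; rewrite l'0 mul0n in hl'; lia.
case: (eqVneq l' 1) => [l'1|l'1].
  by case/eqP: jn2; rewrite l'1 mul1n in hl'; lia.
have l'2 : 2 * c <= l' * c by rewrite leq_mul2r; lia.
have lc : 0 < l' * c by rewrite muln_gt0 l'0; lia.
have JN : N - l' * c < N by lia.
have n1 : r (N - l' * c) != r N by apply: (ranking_neq rk); lia.
have n2 : r (N - l' * c) != r (N - c) by apply: (ranking_neq rk); lia.
have := gap _ JN; move: btw.
by case: odd; do 2 case: ltnP => //=; lia.
Qed.

(** The converse of [spiral_gap] over any alphabet.  Primitivity of the repeated
    block is a consequence: a proper root e of c gives a spiral as well, and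
    both N - c and N - e would have to come just before N. *)
Lemma spiral_of_gap c : odd c -> 2 * c <= N ->
  (forall i, i < c -> s (N - 2 * c + i) = s (N - c + i)) ->
  r (N - c) < r N < r (N - 2 * c) ->
  (forall j, j < N -> ~~ (r (N - c) < r j < r (N - 2 * c))) -> spiral N r s c.
Proof.
move=> oddc c2 eqs /andP[h1 h2] gap; have c0 : 0 < c by case: (c) oddc.
have e2 : loop s N (2 * c) = loop s N c.
  apply: loop_mul_of_letters => // i hi iN.
  have -> : i = N - 2 * c + (i - (N - 2 * c)) by lia.
  rewrite [in RHS]eqs; last lia.
  congr s; lia.
split=> //; last by rewrite h1.
have hc : 0 < c <= N by lia.
have [e [he pe ee]] := root_exists s hc.
suff <- : e = c by [].
have heN : 0 < e <= N by lia.
have [l cl [l0 k1 k2 _]] := orbit_side rk cp heN hc pe (esym ee).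
have [oe ol] : odd e /\ odd l by apply/andP; move: oddc; rewrite cl oddM andbC.
have k3 : r (N - e) < r N by rewrite -k1 ?ol ?orbT.
have hc2 : 0 < 2 * c <= N by lia.
have [|l2 cl2 [l20 _ k4 _]] := orbit_side rk cp heN hc2 pe; first by rewrite e2 ee.
have ol2 : ~~ odd l2.
  have : l2 * e = (2 * l) * e by rewrite -cl2 cl mulnA.
  by move/eqP; rewrite eqn_pmul2r ?oddM; [move/eqP ->; rewrite oddM|lia].
case: (k4 oe ol2) => e2N ee2 k5.
have ne : r (N - 2 * e) != r N by apply: (ranking_neq rk); lia.
have k6 : r N < r (N - 2 * e) by move: k5; lia.
have oute : spiral N r s e by split=> //; rewrite k3.
have g1 := spiral_gap oute (j := N - c).
have g2 := gap (N - e).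
have : r (N - e) = r (N - c) by lia.
by move/(proj2 rk); lia.
Qed.

End SpiralGap.

(** * Extreme words and the realization of a ranking *)

Definition least_word q := fun m => if odd m then q.-1 else 0.
Definition greatest_word q := fun m => if odd m then 0 else q.-1.

Lemma least_word_min k x : (forall i, x i < k) -> ~ alt_lt x (least_word k).
Proof. by move=> xk [j [_]]; rewrite /least_word; have := xk j; case: (odd j); lia. Qed.
Lemma greatest_word_max k x : (forall i, x i < k) -> ~ alt_lt (greatest_word k) x.
Proof. by move=> xk [j [_]]; rewrite /greatest_word; have := xk j; case: (odd j); lia. Qed.

(** The tail must be smaller than q_2^oo, which is the least word on k
    letters. *)
Definition bottom_trap N k (r s : nat -> nat) :=
  [/\ forall i, i < N -> r N < r i, s (N - 2) = 0 & s (N - 1) = k.-1].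
Definition top_trap N k (r s : nat -> nat) :=
  [/\ forall i, i < N -> r i < r N, s (N - 2) = k.-1 & s (N - 1) = 0].

Section Extreme.
Variables (N k : nat) (r s : nat -> nat).
Hypotheses (N2 : 1 < N) (rk : ranking N r) (cp : compatible N r s).
Hypothesis sk : forall i, s i < k.

(** The last letter is the greatest one and is followed by the least shift, so
    that the shift by N - 1 is the greatest one; hence the shift by N - 2 is the
    least one apart from the shift by N. *)
Lemma bottom_trap_extreme : bottom_trap N k r s ->
  (forall j, j < N -> r j <= r (N - 1)) /\ (forall j, j < N -> r (N - 2) <= r j).
Proof.
move=> [mn s2 s1]; have mx j : j < N -> r j <= r (N - 1).
  move=> jN; rewrite leqNgt; apply/negP => h.
  have N1N : N - 1 < N by lia.
  have [h1 h2] := cp N1N jN h.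
  have := sk j; have := h2 _; have -> : (N - 1).+1 = N by lia.
  have jn : j != N - 1 by apply: contraTneq h => ->; rewrite ltnn.
  have := mn j.+1; lia.
split=> // j jN; rewrite leqNgt; apply/negP => h.
have N2N : N - 2 < N by lia.
have [h1 h2] := cp jN N2N h.
have jn : j != N - 1.
  by apply/eqP => e; have := mx (N - 2) N2N; rewrite -e; lia.
have := h2 _; have -> : (N - 2).+1 = N - 1 by lia.
have := mx j.+1; lia.
Qed.

Lemma loop_lt t i : loop s N t i < k. Proof. exact: sk. Qed.

(** The period t of the least word 0 (k-1) 0 (k-1) ... is even unless k = 1, so
    the repeated block ends in 0 (k-1). *)
Lemma loop_least_word t : 0 < t <= N -> loop s N t = least_word k -> s (N - 2) = 0 /\ s (N - 1) = k.-1.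
Proof.
move=> ht e; have e' i : loop s N t i = least_word k i by rewrite e.
case: (ltnP 1 k) => k1; last by have := sk (N - 2); have := sk (N - 1); lia.
have : loop s N t (0 + t) = loop s N t 0 by exact: loop_period.
rewrite !e' /least_word add0n /=; case: ifP => ot; first by lia.
move=> _; have t2 : 1 < t by case: (t) ht ot => // -[].
have o2 : odd (t - 2) = false by rewrite oddB ?ot.
have o1 : odd (t - 1) = true by rewrite oddB ?ot //; lia.
have := e' (t - 2); have := e' (t - 1); rewrite !loop_small ?/least_word ?o1 ?o2; try lia.
have -> : N - t + (t - 1) = N - 1 by lia.
by have -> : N - t + (t - 2) = N - 2 by lia.
Qed.

Lemma loop_greatest_word t : 0 < t <= N -> loop s N t = greatest_word k -> s (N - 2) = k.-1 /\ s (N - 1) = 0.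
Proof.
move=> ht e; have e' i : loop s N t i = greatest_word k i by rewrite e.
case: (ltnP 1 k) => k1; last by have := sk (N - 2); have := sk (N - 1); lia.
have : loop s N t (0 + t) = loop s N t 0 by exact: loop_period.
rewrite !e' /greatest_word add0n /=; case: ifP => ot; first by lia.
move=> _; have t2 : 1 < t by case: (t) ht ot => // -[].
have o2 : odd (t - 2) = false by rewrite oddB ?ot.
have o1 : odd (t - 1) = true by rewrite oddB ?ot //; lia.
have := e' (t - 2); have := e' (t - 1); rewrite !loop_small ?/greatest_word ?o1 ?o2; try lia.
have -> : N - t + (t - 1) = N - 1 by lia.
by have -> : N - t + (t - 2) = N - 2 by lia.
Qed.

Lemma loop_diff_bound t t' j : 0 < t -> 0 < t' ->
  (forall i, i < j -> loop s N t i = loop s N t' i) -> loop s N t j <> loop s N t' j -> j < t * t'.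
Proof.
move=> t0 t0' eqj ne; rewrite ltnNge; apply/negP => le; apply: ne.
rewrite -(subnK le) [in LHS]mulnC !(period_mul (loop_period _ _ _)) mulnC eqj //.
have : 0 < t * t' by rewrite muln_gt0 t0.
lia.
Qed.

(** If no shift is below N, the least word works.  Otherwise let q^oo be the
    point of the predecessor of N.  It is not the greatest word, as there would
    be a top trap or a spiral; so a long even power of q followed by the
    greatest word is slightly above q^oo. *)
Lemma separating_tail : spiral_free N r s -> ~ bottom_trap N k r s -> ~ top_trap N k r s ->
  exists x, [/\ forall i, x i < k &
    forall t, 0 < t <= N -> (r (N - t) < r N -> alt_lt (loop s N t) x) /\
                            (r N < r (N - t) -> alt_lt x (loop s N t))].
Proof.
move=> no nb nt; have N0 : 0 < N by lia.
have k0 : 0 < k by have := sk 0; lia.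
have neN t : 0 < t <= N -> r (N - t) != r N by move=> ht; apply: (ranking_neq rk); lia.
case: (pselect (exists2 j, j < N & r j < r N)) => [ex|nex]; last first.
  exists (least_word k); split; first by move=> i; rewrite /least_word; case: ifP; lia.
  move=> t ht; split=> [h|h]; first by case: nex; exists (N - t) => //; lia.
  case: (alt_lt_total (least_word k) (loop s N t)) => // [e|]; last by move/least_word_min; case; exact: loop_lt.
  case: nb; have [a1 a2] := loop_least_word ht (esym e); split=> // i iN.
  have hi : 0 < N - i <= N by lia.
  have := neN _ hi; rewrite (subKn (ltnW iN)); case: ltngtP => // h' _.
  by case: nex; exists i.
have [P [PN up dn predP]] := cut_point rk cp N0.
have {}predP := predP ex.
have hP : 0 < N - P <= N by lia.
set tP := N - P in up dn hP.
have rP : r (N - tP) < r N by rewrite subKn // ltnW.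
have up' t : 0 < t <= N -> r (N - t) < r N -> alt_lt (loop s N t) (loop s N tP) \/ loop s N t = loop s N tP.
  move=> ht h; have := up t ht h; case: (alt_lt_total (loop s N t) (loop s N tP)) => //; [by left|by right].
have dn' t : 0 < t <= N -> r N < r (N - t) -> alt_lt (loop s N tP) (loop s N t).
  move=> ht h; have := dn t ht h; case: (alt_lt_total (loop s N t) (loop s N tP)) => // e _.
  by have := same_side rk cp no ht hP e; lia.
have nmax : alt_lt (loop s N tP) (greatest_word k).
  case: (alt_lt_total (loop s N tP) (greatest_word k)) => // [e|]; last by move/greatest_word_max; case; exact: loop_lt.
  case: nt; have [a1 a2] := loop_greatest_word hP e; split=> // i iN.
  have hi : 0 < N - i <= N by lia.
  have := neN _ hi; rewrite (subKn (ltnW iN)); case: ltngtP => // h' _.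
  have := dn' _ hi; rewrite (subKn (ltnW iN)) => /(_ h').
  by rewrite e => /greatest_word_max; case; exact: loop_lt.
(* The number M is a multiple of the period of q^oo, an even number, and it
   exceeds the place where two different points can differ for the first time. *)
pose M := N * N * 2 * tP.
have tPM i : loop s N tP (M + i) = loop s N tP i.
  by rewrite addnC /M (period_mul (loop_period _ _ _)).
have oM : odd M = false by rewrite /M !oddM /= andbF.
exists (fun m => if m < M then loop s N tP m else greatest_word k m); split.
  by move=> i; case: ifP => _; [exact: loop_lt|rewrite /greatest_word; case: ifP; lia].
move=> t ht; set x := (fun m => _).
have px : alt_lt (loop s N tP) x.
  case: nmax => j [eqj dj]; exists (M + j); split.
    move=> i ij; rewrite /x; case: ltnP => // Mi.
    rewrite -(subnKC Mi) tPM eqj; last lia.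
    by rewrite /greatest_word oddD oM.
  have -> : x (M + j) = greatest_word k j by rewrite /x ltnNge leq_addr /greatest_word oddD oM.
  by rewrite oddD oM tPM.
split=> [h|h].
  by case: (up' t ht h) => [g|->] //; apply: alt_lt_trans px.
case: (dn' t ht h) => j [eqj dj].
have jb : j < tP * t.
  by apply: (loop_diff_bound _ _ eqj); [lia|lia|move=> e; move: dj; rewrite e ltnn; case: ifP].
have jM : j < M.
  apply: leq_trans jb _; rewrite /M mulnC leq_mul2r; apply/orP; right.
  have : t <= N * N by apply: leq_trans (leq_pmulr N N0); lia.
  lia.
exists j; rewrite /x jM; split=> // i ij; rewrite ifT; [exact: eqj|lia].
Qed.

(** With a tail that separates the points strictly, no two shifts are equal, and
    by uniqueness their order is that of r. *)
Lemma realize : spiral_free N r s -> ~ bottom_trap N k r s -> ~ top_trap N k r s ->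
  exists w, [/\ forall i, w i < k, (forall i, i < N -> w i = s i) &
    forall i j, i <= N -> j <= N -> r i < r j <-> alt_lt (tail w i) (tail w j)].
Proof.
move=> no nb nt; have [x [xk T]] := separating_tail no nb nt.
have [r' [rk' cp' rE T']] := @lexicographic_ranking s N x _ (@inward_flip N) (@inward_inj N).
have nx t : 0 < t <= N -> loop s N t <> x.
  move=> ht e; have [a1 a2] := T t ht.
  have : r (N - t) != r N by apply: (ranking_neq rk); lia.
  by case: ltngtP => // h _; [have := a1 h|have := a2 h]; rewrite e; apply: alt_lt_irr.
have eT t : 0 < t <= N -> (r (N - t) < r N) = (r' (N - t) < r' N).
  move=> ht; have [a1 a2] := T t ht; apply/idP/idP => [/a1 h|].
    by apply/T' => //; left.
  have ne : r (N - t) != r N by apply: (ranking_neq rk); lia.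
  case/T' => // [g|[e _]]; last by case: (nx t ht).
  by case: ltngtP ne => // /a2 /(alt_lt_asym g).
have eqr := compatible_unique rk rk' cp cp' eT.
exists (prepend s N x); split.
- by move=> i; rewrite /prepend; case: ifP.
- by move=> i; apply: prepend_prefix.
have neq i j : i < j -> j <= N -> tail (prepend s N x) i <> tail (prepend s N x) j.
  move=> ij jN e; apply: (nx (j - i)); first lia.
  have := congr1 (fun v => tail v (N - j)) e; rewrite !tail_tail subnKC //.
  have -> : i + (N - j) = N - (j - i) by lia.
  by rewrite tail_prepend => /tail_fix -> //; lia.
move=> i j iN jN; rewrite eqr // rE //; split=> [[//|[e d]]|]; last by left.
case: (ltngtP i j) => [h|h|h]; [by case: (neq i j)|by case: (neq j i)|].
by move: d; rewrite h ltnn.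
Qed.

End Extreme.

Section Converse.
Variables (N k : nat) (r w : nat -> nat).
Hypothesis rw : forall i j, i <= N -> j <= N -> r i < r j <-> alt_lt (tail w i) (tail w j).

Lemma realized_compatible : compatible N r w.
Proof.
move=> i j iN jN /(rw (ltnW iN) (ltnW jN)); rewrite tail_cons => h; split.
  by case: h => [|[]]; lia.
by move=> e; apply/rw => //; case: h => [|[]] //; rewrite e ltnn.
Qed.

Lemma prepend_tail : prepend w N (tail w N) = w.
Proof. by apply/funext => i; rewrite /prepend /tail; case: ltnP => // /subnKC ->. Qed.

Lemma realized_side t : 0 < t <= N ->
  (r (N - t) < r N <-> alt_lt (loop w N t) (tail w N)) /\
  (r N < r (N - t) <-> alt_lt (tail w N) (loop w N t)).
Proof.
move=> ht; have := tail_gt w (tail w N) ht; have := tail_lt w (tail w N) ht.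
by rewrite prepend_tail => h1 h2; split; rewrite rw //; lia.
Qed.

Hypotheses (N2 : 1 < N) (wk : forall i, w i < k).

(** For a real word the side of a shift is determined by its point q_t^oo, which
    excludes spirals; and no tail is below the least or above the greatest
    word. *)
Lemma realized_good : [/\ spiral_free N r w, ~ bottom_trap N k r w & ~ top_trap N k r w].
Proof.
split.
- apply: spiral_free_of_sides => t t' ht ht' e.
  have [a _] := realized_side ht; have [b _] := realized_side ht'.
  by apply/idP/idP => [/a|/b] h; [apply/b|apply/a]; move: h; rewrite e.
- move=> [mn a b]; have ht : 0 < 2 <= N by [].
  have [_ h] := realized_side ht; have h0 : r N < r (N - 2) by apply: mn; lia.
  have e : loop w N 2 = least_word k.
    apply/funext => m; rewrite /loop modn2 /least_word; case: odd => /=.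
      by rewrite -b; congr w; lia.
    by rewrite addn0.
  by move/h: h0; rewrite e; apply: least_word_min => i; exact: wk.
- move=> [mx a b]; have ht : 0 < 2 <= N by [].
  have [h _] := realized_side ht; have h0 : r (N - 2) < r N by apply: mx; lia.
  have e : loop w N 2 = greatest_word k.
    apply/funext => m; rewrite /loop modn2 /greatest_word; case: odd => /=.
      by rewrite -b; congr w; lia.
    by rewrite addn0.
  by move/h: h0; rewrite e; apply: greatest_word_max => i; exact: wk.
Qed.

End Converse.

(** * The mirror symmetry *)

Section Mirror.
Variables (N k : nat) (r s : nat -> nat).
Hypotheses (rk : ranking N r) (sk : forall i, s i < k).
Let r' i := N - r i.
Let s' i := k.-1 - s i.

Lemma mirror_lt i j : i <= N -> j <= N -> (r' i < r' j) = (r j < r i).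
Proof. by move=> iN jN; have := proj1 rk i iN; have := proj1 rk j jN; rewrite /r'; lia. Qed.

Lemma mirror_letters i j : (s' i = s' j) <-> (s i = s j).
Proof. by have := sk i; have := sk j; rewrite /s'; lia. Qed.

Lemma mirror_compatible : compatible N r s -> compatible N r' s'.
Proof.
move=> cp i j iN jN; rewrite (mirror_lt (ltnW iN) (ltnW jN)) => /(cp _ _ jN iN)[h1 h2]; split.
  by rewrite /s'; lia.
by move/mirror_letters => e; rewrite (mirror_lt jN iN); apply: h2.
Qed.

Lemma mirror_loop t t' : loop s' N t = loop s' N t' <-> loop s N t = loop s N t'.
Proof.
split=> e; apply/funext => m; have := congr1 (@^~ m) e; rewrite /loop.
  by move/mirror_letters.
by move=> h; apply/mirror_letters.
Qed.

Lemma mirror_primitive_suffix c : primitive_suffix s' N c <-> primitive_suffix s N c.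
Proof. by split=> h e he /mirror_loop; apply: h. Qed.

Lemma mirror_spiral c : spiral_rev N r s c <-> spiral N r' s' c.
Proof.
split=> -[oc c2 pc e2 h]; split=> //.
- exact/mirror_primitive_suffix.
- exact/mirror_loop.
- by rewrite !mirror_lt; lia.
- exact/mirror_primitive_suffix.
- exact/mirror_loop.
- by move: h; rewrite !mirror_lt; lia.
Qed.

Lemma mirror_top : 1 < N -> top_trap N k r s <-> bottom_trap N k r' s'.
Proof.
move=> N2; have s2 := sk (N - 2); have s1 := sk (N - 1).
split=> -[h1 h2 h3]; split; try by [rewrite /s'; lia | move: h2 h3; rewrite /s'; lia].
  by move=> i iN; rewrite mirror_lt ?h1 //; lia.
by move=> i iN; have := h1 i iN; rewrite mirror_lt //; lia.
Qed.

End Mirror.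

(** * Counting permutations for a given prefix *)

Definition rank_of N (pi : 'S_N.+1) (i : nat) : nat := pi (inord i).
Definition letter N k (s : {ffun 'I_N -> 'I_k}) (i : nat) : nat :=
  if insub i is Some j then s j : nat else 0.

Lemma letter_ord N k (s : {ffun 'I_N -> 'I_k}) (i : 'I_N) : letter s i = s i.
Proof. by rewrite /letter valK. Qed.

Lemma letter_lt N k (s : {ffun 'I_N -> 'I_k}) i : 0 < k -> letter s i < k.
Proof. by rewrite /letter; case: insub. Qed.

Lemma rank_of_ranking N (pi : 'S_N.+1) : ranking N (rank_of pi).
Proof.
split=> [i iN|i j iN jN /val_inj /perm_inj e]; first by rewrite -ltnS ltn_ord.
by rewrite -(inordK (n' := N) (m := i)) // e inordK.
Qed.

Lemma card_ord_lt n m : m <= n -> #|[set v : 'I_n | v < m]| = m.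
Proof.
move=> mn; rewrite -sum1_card (eq_bigl (fun v : 'I_n => v < m)).
  by rewrite (big_ord_narrow mn) sum1_card card_ord.
by move=> v; rewrite inE.
Qed.

Lemma perm_rank n (pi : 'S_n) i : #|[set j | pi j < pi i]| = pi i.
Proof.
rewrite -[RHS](card_ord_lt (ltnW (ltn_ord (pi i)))).
rewrite -[RHS](card_preimset _ (@perm_inj _ pi)); apply: eq_card => j.
by rewrite !inE.
Qed.

Lemma perm_order_inj N (pi sigma : 'S_N.+1) :
  (forall i j, i <= N -> j <= N -> (rank_of pi i < rank_of pi j) = (rank_of sigma i < rank_of sigma j)) ->
  pi = sigma.
Proof.
move=> h; apply/permP => i; apply: val_inj; rewrite /= -[LHS]perm_rank -[RHS]perm_rank.
apply: eq_card => j; rewrite !inE.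
by have := h j i (leq_ord j) (leq_ord i); rewrite /rank_of !inord_val.
Qed.

Lemma perm_of_ranking N r : ranking N r ->
  exists pi : 'S_N.+1, forall i, i <= N -> rank_of pi i = r i.
Proof.
move=> [rN ri]; pose f (i : 'I_N.+1) : 'I_N.+1 := inord (r i).
have fi : injective f.
  move=> i j /(congr1 val); have iN := leq_ord i; have jN := leq_ord j.
  by rewrite /f /= !inordK ?ltnS ?rN // => /(ri _ _ iN jN) /val_inj.
by exists (perm fi) => i iN; rewrite /rank_of permE /f !inordK // ltnS rN.
Qed.

Lemma compatible_eq_rank N r r' s : (forall i, i <= N -> r i = r' i) -> compatible N r s -> compatible N r' s.
Proof.
move=> e cp i j iN jN; rewrite -(e i (ltnW iN)) -(e j (ltnW jN)) -(e i.+1 iN) -(e j.+1 jN) => h.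
by have := cp i j iN jN h.
Qed.

Lemma spiral_eq_rank N r r' s c : (forall i, i <= N -> r i = r' i) -> spiral N r s c -> spiral N r' s c.
Proof. by move=> e [oc c2 pc e2 h]; split=> //; rewrite -!e //; apply: leq_subr. Qed.

Lemma spiral_rev_eq_rank N r r' s c : (forall i, i <= N -> r i = r' i) -> spiral_rev N r s c -> spiral_rev N r' s c.
Proof. by move=> e [oc c2 pc e2 h]; split=> //; rewrite -!e //; apply: leq_subr. Qed.

Lemma spiral_free_eq_rank N r r' s : (forall i, i <= N -> r i = r' i) -> spiral_free N r s -> spiral_free N r' s.
Proof.
move=> e no c; have [n1 n2] := no c.
have e' i : i <= N -> r' i = r i by move/e.
by split=> [/(spiral_eq_rank e')|/(spiral_rev_eq_rank e')].
Qed.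

Section FixedWord.
Variables (N k : nat) (s : {ffun 'I_N -> 'I_k}).
Local Notation s_ := (letter s).

Lemma perm_unique (pi sigma : 'S_N.+1) :
  compatible N (rank_of pi) s_ -> compatible N (rank_of sigma) s_ ->
  (forall t, 0 < t <= N ->
     rank_of pi (N - t) < rank_of pi N <-> rank_of sigma (N - t) < rank_of sigma N) ->
  pi = sigma.
Proof.
move=> c1 c2 h; apply: perm_order_inj.
apply: (compatible_unique (rank_of_ranking pi) (rank_of_ranking sigma) c1 c2).
by move=> t /h e; apply/idP/idP => /e.
Qed.

(** One permutation for each primitive suffix, with the tail just above the
    corresponding point, and one permutation with the tail below everything. *)
Lemma card_spiral_free : 0 < N -> 0 < k ->
  #|[set pi : 'S_N.+1 | `[< compatible N (rank_of pi) s_ /\ spiral_free N (rank_of pi) s_ >]]| =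
  #|[set c : 'I_N | `[< primitive_suffix s_ N c.+1 >]]|.+1.
Proof.
move=> N0 k0.
pose side (o : option 'I_N) t := if o is Some c then ~ alt_lt (loop s_ N c.+1) (loop s_ N t) else False.
have ex (o : option 'I_N) : exists pi : 'S_N.+1,
    [/\ compatible N (rank_of pi) s_, spiral_free N (rank_of pi) s_ &
      forall t, 0 < t <= N -> rank_of pi (N - t) < rank_of pi N <-> side o t].
  have build r : ranking N r -> compatible N r s_ -> spiral_free N r s_ ->
      (forall t, 0 < t <= N -> r (N - t) < r N <-> side o t) -> exists pi : 'S_N.+1,
    [/\ compatible N (rank_of pi) s_, spiral_free N (rank_of pi) s_ &
      forall t, 0 < t <= N -> rank_of pi (N - t) < rank_of pi N <-> side o t].
    move=> rk cp no T; have [pi e] := perm_of_ranking rk.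
    have e' i : i <= N -> r i = rank_of pi i by move/e.
    exists pi; split; [exact: compatible_eq_rank cp|exact: spiral_free_eq_rank no|].
    by move=> t ht; rewrite !e ?leq_subr //; apply: T.
  case: o build => [c|] build.
    have [|r [rk cp no T]] := @exists_above N s_ c.+1; first by rewrite ltn_ord.
    exact: (build r).
  have [|r [rk cp no T]] := @exists_bottom N s_ k; first by move=> i; apply: letter_lt.
  by apply: (build r) => // t ht; split=> // /T; apply.
have [f fP] := choice ex.
have inj : {in [set o : option 'I_N | if o is Some c then `[< primitive_suffix s_ N c.+1 >] else true] &, injective f}.
  move=> o o'; rewrite !inE => po po' e.
  have T t : 0 < t <= N -> side o t <-> side o' t.
    have [_ _ T1] := fP o; have [_ _ T2] := fP o'.
    by move=> ht; rewrite -T1 // -T2 // e.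
  case: o o' po po' T {e} => [c|] [c'|] //=.
  - move=> /asboolP pc /asboolP pc' T; have T1 := T c.+1 _; have T2 := T c'.+1 _.
    have a1 : ~ alt_lt (loop s_ N c'.+1) (loop s_ N c.+1) by apply/T1; [exact: ltn_ord|exact: alt_lt_irr].
    have a2 : ~ alt_lt (loop s_ N c.+1) (loop s_ N c'.+1) by apply/T2; [exact: ltn_ord|exact: alt_lt_irr].
    have e : loop s_ N c.+1 = loop s_ N c'.+1.
      by case: (alt_lt_total (loop s_ N c.+1) (loop s_ N c'.+1)).
    congr Some; apply: val_inj => /=; case: (ltngtP c c') => // lt.
      by case: (pc' c.+1).
    by case: (pc c'.+1).
  - by move=> _ _ T; case: (proj1 (T c.+1 (ltn_ord c))); apply: alt_lt_irr.
  - by move=> _ _ T; case: (proj2 (T c'.+1 (ltn_ord c'))); apply: alt_lt_irr.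
have -> : [set pi : 'S_N.+1 | `[< compatible N (rank_of pi) s_ /\ spiral_free N (rank_of pi) s_ >]] =
   f @: [set o : option 'I_N | if o is Some c then `[< primitive_suffix s_ N c.+1 >] else true].
  apply/setP => pi; rewrite inE; apply/asboolP/imsetP => [[cp no]|[o _ ->]]; last first.
    by case: (fP o).
  have [T|[c [hc pc T]]] := spiral_free_classify (rank_of_ranking pi) cp N0 no.
    exists None; rewrite ?inE //; have [c1 c2 T'] := fP None.
    by apply: perm_unique => // t ht; rewrite T' //; split=> // /T; apply.
  have cN : c.-1 < N by lia.
  have c1 : (Ordinal cN).+1 = c by rewrite /= prednK //; lia.
  exists (Some (Ordinal cN)); first by rewrite inE c1; apply/asboolP.
  have [cp2 c2 T'] := fP (Some (Ordinal cN)).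
  by apply: perm_unique => // t ht; rewrite T' // /side c1 T.
rewrite card_in_imset // [LHS](cardsD1 None) inE /= add1n; congr S.
rewrite -[RHS](card_imset _ (@Some_inj _)); apply: eq_card => o.
rewrite !inE; case: o => [c|] /=; last by apply/esym/negbTE/imsetP => -[].
by rewrite (mem_imset _ _ (@Some_inj _)) inE.
Qed.

(** In a spiral the comparisons with N are determined by s ([spiral_side]), and
    so is the permutation. *)
Lemma card_spiral c : #|[set pi : 'S_N.+1 | `[< compatible N (rank_of pi) s_ /\ spiral N (rank_of pi) s_ c >]]| =
  `[< [/\ odd c, 2 * c <= N, primitive_suffix s_ N c & loop s_ N (2 * c) = loop s_ N c] >].
Proof.
case: asboolP => [[oc c2 pc e2]|n]; last first.
  apply/eqP; rewrite cards_eq0; apply/eqP/setP => pi; rewrite !inE; apply/asboolP.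
  by case=> _ [oc c2 pc e2 _]; apply: n.
have [r [rk cp o]] := exists_spiral oc c2 pc e2; have [pi e] := perm_of_ranking rk.
have e' i : i <= N -> r i = rank_of pi i by move/e.
have cp1 := compatible_eq_rank e' cp; have o1 := spiral_eq_rank e' o.
apply/eqP/cards1P; exists pi; apply/setP => sigma; rewrite !inE.
apply/asboolP/eqP => [[cp2 o2]|->] //.
apply: perm_unique => // t ht.
by rewrite (spiral_side (rank_of_ranking sigma) cp2 o2 ht) (spiral_side (rank_of_ranking pi) cp1 o1 ht).
Qed.

Lemma card_bottom_trap : 0 < k -> #|[set pi : 'S_N.+1 | `[< compatible N (rank_of pi) s_ /\ bottom_trap N k (rank_of pi) s_ >]]| =
  `[< s_ (N - 2) = 0 /\ s_ (N - 1) = k.-1 >].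
Proof.
move=> k0; case: asboolP => [[a b]|n]; last first.
  apply/eqP; rewrite cards_eq0; apply/eqP/setP => pi; rewrite !inE; apply/asboolP.
  by case=> _ [_ a b]; apply: n.
have [|r [rk cp no T]] := @exists_bottom N s_ k; first by move=> i; apply: letter_lt.
have [pi e] := perm_of_ranking rk.
have e' i : i <= N -> r i = rank_of pi i by move/e.
have cp1 := compatible_eq_rank e' cp.
have bot i : i < N -> rank_of pi N < rank_of pi i.
  move=> iN; rewrite !e ?(ltnW iN) //.
  have ht : 0 < N - i <= N by lia.
  have iNn : i != N by lia.
  have := ranking_neq rk (ltnW iN) (leqnn N) iNn; have := T _ ht.
  by rewrite (subKn (ltnW iN)); case: ltngtP.
apply/eqP/cards1P; exists pi; apply/setP => sigma; rewrite !inE.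
apply/asboolP/eqP => [[cp2 [o2 _ _]]|->] //.
apply: perm_unique => // t ht; split=> h.
  by have := o2 (N - t); lia.
by have := bot (N - t); lia.
Qed.

End FixedWord.

Import GRing.Theory.

(** * Moebius inversion and primitive words *)

Section Moebius.
Local Open Scope ring_scope.

Lemma moebius_mul_coprime q f : prime q -> (0 < f)%N -> ~~ (q %| f)%N ->
  moebius (q * f) = - moebius f.
Proof.
move=> pq f0 qf.
have q0 : (0 < q)%N by apply: prime_gt0.
have pe : perm_eq (primes (q * f)) (q :: primes f).
  apply: uniq_perm; first exact: primes_uniq.
    by rewrite /= primes_uniq mem_primes (negbTE qf) !andbF.
  by move=> x; rewrite primesM // primes_prime // !inE.
rewrite /moebius (perm_all _ pe) (perm_size pe) /=.
have -> : logn q (q * f) == 1%N.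
  by rewrite lognM // logn_prime // eqxx lognE (negbTE qf) !andbF.
have -> : all (fun r => logn r (q * f) == 1)%N (primes f) = all (fun r => logn r f == 1)%N (primes f).
  apply: eq_in_all => r; rewrite mem_primes => /and3P[pr _ rf].
  have rq : r != q by apply: contraTneq rf => ->.
  by rewrite lognM // logn_prime // (negbTE rq).
by rewrite /=; case: all; rewrite ?oppr0 // exprS mulN1r.
Qed.

Lemma moebius_mul_dvd q f : prime q -> (0 < f)%N -> (q %| f)%N ->
  moebius (q * f) = 0.
Proof.
move=> pq f0 qf; rewrite /moebius; case: ifP => // /allP /(_ q).
rewrite mem_primes pq muln_gt0 (prime_gt0 pq) f0 dvdn_mulr // => /(_ isT).
rewrite lognM ?(prime_gt0 pq) // logn_prime // eqxx.
by rewrite lognE pq f0 qf.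
Qed.

(** For a prime factor q of m, the divisors d that are prime to q cancel against
    the divisors q d, and the Moebius function vanishes at the multiples of
    q^2. *)
Lemma sum_moebius m : (0 < m)%N ->
  \sum_(d <- divisors m) moebius d = (m == 1%N)%:Z.
Proof.
move=> m0; case: (ltngtP m 1%N) => [|m1|->]; [by case: (m) m0 | |]; last first.
  by rewrite big_seq1.
pose q := pdiv m; have pq : prime q by apply: pdiv_prime.
have qm : (q %| m)%N by apply: pdiv_dvd.
have q0 := prime_gt0 pq.
have mq0 : (0 < m %/ q)%N by rewrite divn_gt0 // dvdn_leq.
rewrite (bigID (fun d => q %| d)%N) /=.
have pe : perm_eq [seq d <- divisors m | (q %| d)%N] [seq (q * f)%N | f <- divisors (m %/ q)].
  apply: uniq_perm.
  - by rewrite filter_uniq ?divisors_uniq.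
  - rewrite map_inj_uniq ?divisors_uniq // => x y /eqP.
    by rewrite eqn_pmul2l // => /eqP.
  - move=> x; rewrite mem_filter -dvdn_divisors //; apply/andP/mapP.
      case=> /dvdnP[f ->] fm; exists f; last by rewrite mulnC.
      by rewrite -dvdn_divisors // dvdn_divRL.
    case=> f; rewrite -dvdn_divisors // dvdn_divRL // mulnC => fm ->.
    by rewrite dvdn_mulr // mulnC.
rewrite -big_filter (perm_big _ pe) big_map (bigID (fun d => q %| d)%N) /=.
rewrite big1_seq ?add0r; last first.
  move=> f /andP[qf]; rewrite -dvdn_divisors // => fm; apply: moebius_mul_dvd => //.
  by apply: dvdn_gt0 fm.
rewrite -big_filter -[X in _ + X]big_filter.
have pe2 : perm_eq [seq d <- divisors (m %/ q) | ~~ (q %| d)%N] [seq d <- divisors m | ~~ (q %| d)%N].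
  apply: uniq_perm; try by rewrite filter_uniq ?divisors_uniq.
  move=> x; rewrite !mem_filter -!dvdn_divisors //.
  case qx : (q %| x)%N => //=; rewrite dvdn_divRL // Gauss_dvd ?qm ?andbT //.
  by rewrite coprime_sym prime_coprime // qx.
rewrite (perm_big _ pe2) /= -big_split /= big_filter big1_seq // => x /andP[qx].
rewrite -dvdn_divisors // => xm; rewrite moebius_mul_coprime ?addNr //.
exact: dvdn_gt0 xm.
Qed.

(** Exchange the sums over e | t and d | t / e: the condition is symmetric in d
    and e, and the inner sum of the Moebius function vanishes unless d = t. *)
Lemma moebius_inversion (g : nat -> int) k t : (0 < t)%N ->
  (forall d, (d %| t)%N -> \sum_(e <- divisors d) g e = k%:Z ^+ d) ->
  psi k t = g t.
Proof.
move=> t0 h.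
have divE (F : nat -> int) d : (d %| t)%N ->
    \sum_(e <- divisors d) F e = \sum_(0 <= e < t.+1 | (e %| d)%N) F e.
  move=> dt; have d0 : (0 < d)%N by apply: dvdn_gt0 dt.
  rewrite -[RHS]big_filter; apply: perm_big; apply: uniq_perm.
  - exact: divisors_uniq.
  - by rewrite filter_uniq // iota_uniq.
  - move=> x; rewrite -dvdn_divisors // mem_filter mem_index_iota /=.
    case xd : (x %| d)%N => //=; rewrite ltnS; apply/esym.
    by apply: dvdn_leq => //; apply: dvdn_trans xd dt.
rewrite /psi divE //.
transitivity (\sum_(0 <= e < t.+1 | (e %| t)%N) \sum_(0 <= d < t.+1 | (d %| t %/ e)%N) moebius e * g d).
  apply: eq_bigr => e et; rewrite -mulr_sumr -divE ?h //; exact: dvdn_div.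
rewrite (exchange_big_dep (fun d => d %| t)%N) /=; last first.
  by move=> e d et det; apply: dvdn_trans det (dvdn_div et).
rewrite big_mkcond (bigD1_seq t) ?iota_uniq ?mem_index_iota ?leq0n ?ltnSn //=.
rewrite dvdnn [X in _ + X]big1 ?addr0 => [|d dnt]; last first.
  case: ifP => // dt.
  rewrite (eq_bigl (fun e => e %| t %/ d)%N) => [|e].
    have d0 : (0 < d)%N by apply: dvdn_gt0 dt.
    rewrite -mulr_suml -divE ?dvdn_div // sum_moebius ?divn_gt0 ?(dvdn_leq t0) //.
    rewrite (_ : (_ == _) = false) ?mul0r //.
    apply: contraNF dnt => /eqP e1; apply/eqP.
    by rewrite -(divnK dt) e1 mul1n.
  apply/andP/idP => [[et]|edt].
    by rewrite dvdn_divRL // dvdn_divRL // mulnC.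
  have et : (e %| t)%N by apply: dvdn_trans edt (dvdn_div dt).
  by split=> //; move: edt; rewrite dvdn_divRL // dvdn_divRL // mulnC.
rewrite (eq_bigl (fun e => e %| 1)%N) => [|e].
  by rewrite -mulr_suml -divE ?dvd1n // sum_moebius // mul1r.
apply/andP/idP => [[et]|]; last by rewrite dvdn1 => /eqP ->; rewrite dvd1n divn1.
by rewrite dvdn_divRL // -{2}[t]muln1 dvdn_pmul2l.
Qed.

End Moebius.

Lemma loop_transfer N N' s s' c e : 0 < e <= c -> c <= N -> c <= N' ->
  (forall j, j < c -> s (N - c + j) = s' (N' - c + j)) -> loop s N e = loop s' N' e.
Proof.
move=> he cN cN' h; apply/funext => m; rewrite /loop.
have lt : m %% e < e by rewrite ltn_mod; lia.
have -> : N - e + m %% e = N - c + (c - e + m %% e) by lia.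
have -> : N' - e + m %% e = N' - c + (c - e + m %% e) by lia.
by apply: h; lia.
Qed.

Lemma primitive_suffix_transfer N N' s s' c : 0 < c -> c <= N -> c <= N' ->
  (forall j, j < c -> s (N - c + j) = s' (N' - c + j)) -> primitive_suffix s N c -> primitive_suffix s' N' c.
Proof.
move=> c0 cN cN' h p e he.
rewrite -(@loop_transfer N N' s s' c e) ?cN ?cN' //; last lia.
by rewrite -(@loop_transfer N N' s s' c c) ?cN ?cN' ?c0 ?leqnn //; apply: p.
Qed.

Section CountWords.
Variable k : nat.

Definition num_primitive c := #|[set u : {ffun 'I_c -> 'I_k} | `[< primitive_suffix (letter u) c c >]]|.

(** A word that ends in q^l is given by its other letters and by q. *)
Lemma card_power_words N c l : 0 < c -> 0 < l -> l * c <= N ->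
  #|[set s : {ffun 'I_N -> 'I_k} |
     `[< primitive_suffix (letter s) N c /\ loop (letter s) N (l * c) = loop (letter s) N c >]]| =
  k ^ (N - l * c) * num_primitive c.
Proof.
case: c => // c _ l0 lN; set C := c.+1 in lN *.
have cl : C <= l * C by case: (l) l0 => // l' _; rewrite mulSn; lia.
pose g (pu : {ffun 'I_(N - l * C) -> 'I_k} * {ffun 'I_C -> 'I_k}) : {ffun 'I_N -> 'I_k} :=
  [ffun i : 'I_N => if insub (i : nat) is Some j then pu.1 j else
     pu.2 (inord ((i - (N - l * C)) %% C))].
have svl n (f : {ffun 'I_n -> 'I_k}) i (h : i < n) : letter f i = f (Ordinal h).
  by rewrite -(letter_ord f (Ordinal h)).
have g1 pu i : i < N - l * C -> letter (g pu) i = letter pu.1 i.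
  move=> h; have hN : i < N by lia.
  by rewrite (svl _ _ _ hN) (svl _ _ _ h) ffunE /= insubT.
have g2 pu i : N - l * C <= i < N -> letter (g pu) i = letter pu.2 ((i - (N - l * C)) %% C).
  move=> /andP[h hN]; rewrite (svl _ _ _ hN) ffunE /= insubF; last by lia.
  have h2 : (i - (N - l * C)) %% C < C by rewrite ltn_mod.
  by rewrite (svl _ _ _ h2); congr (nat_of_ord (pu.2 _)); apply: val_inj; rewrite /= inordK.
have svinj n (f f' : {ffun 'I_n -> 'I_k}) : (forall i, i < n -> letter f i = letter f' i) -> f = f'.
  move=> h; apply/ffunP => i; apply: val_inj => /=; rewrite -!letter_ord; exact: h.
have ginj : injective g.
  move=> [p u] [p' u'] e; have e' i : letter (g (p, u)) i = letter (g (p', u')) i by rewrite e.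
  congr pair; apply: svinj => i h.
    by have := e' i; rewrite !g1.
  have := e' (N - l * C + i); rewrite !g2 /=; try lia.
  have -> : N - l * C + i - (N - l * C) = i by lia.
  by rewrite modn_small.
have suf p u j : j < C -> letter (g (p, u)) (N - C + j) = letter u (C - C + j).
  move=> jC; rewrite g2 /=; last by lia.
  have [l' el] : exists l', l = l'.+1 by exists l.-1; lia.
  have -> : N - C + j - (N - l * C) = l' * C + j.
    by move: lN; rewrite el mulSn; lia.
  by rewrite modnMDl modn_small // subnn.
have -> : [set s : {ffun 'I_N -> 'I_k} |
     `[< primitive_suffix (letter s) N C /\ loop (letter s) N (l * C) = loop (letter s) N C >]] =
   g @: setX setT [set u : {ffun 'I_C -> 'I_k} | `[< primitive_suffix (letter u) C C >]].
  apply/setP => s; rewrite inE; apply/asboolP/imsetP.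
    case=> pc e; pose p : {ffun 'I_(N - l * C) -> 'I_k} :=
      [ffun j => s (widen_ord (leq_subr _ _) j)].
    have hu (j : 'I_C) : N - C + j < N by have := ltn_ord j; lia.
    pose u : {ffun 'I_C -> 'I_k} := [ffun j => s (Ordinal (hu j))].
    have es : s = g (p, u).
      apply: svinj => i iN; case: (ltnP i (N - l * C)) => h.
        by rewrite g1 // (svl _ _ _ h) (svl _ _ _ iN) ffunE; congr (nat_of_ord (s _)); apply: val_inj.
      rewrite g2 ?h //; have h2 : (i - (N - l * C)) %% C < C by rewrite ltn_mod.
      rewrite (svl _ _ _ h2) ffunE /= -(svl _ s).
      have := congr1 (@^~ (i - (N - l * C))) e; rewrite loop_small; [|lia|lia].
      by have -> : N - l * C + (i - (N - l * C)) = i by lia.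
    exists (p, u) => //; rewrite !inE /=; apply/asboolP.
    apply: (@primitive_suffix_transfer N C (letter s)) => //; first by lia.
    by move=> j jC; rewrite es suf.
  case=> -[p u]; rewrite !inE /= => /asboolP pu ->; split.
    apply: (@primitive_suffix_transfer C N (letter u)) => //; first by lia.
    by move=> j jC; rewrite suf.
  apply: loop_mul_of_letters => // i hi iN.
  rewrite !g2; try lia.
  have -> : i + C - (N - l * C) = i - (N - l * C) + C by lia.
  by rewrite modnDr.
rewrite card_imset // cardsX cardsT card_ffun !card_ord //.
Qed.

(** Every word of length t is a power of a unique primitive word, its root. *)
Lemma sum_num_primitive t : 0 < t -> \sum_(d <- divisors t) num_primitive d = k ^ t.
Proof.
move=> t0.
have e d : d \in divisors t -> num_primitive d =
    \sum_(u : {ffun 'I_t -> 'I_k}) (`[< primitive_suffix (letter u) t d /\ loop (letter u) t t = loop (letter u) t d >] : nat).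
  rewrite -dvdn_divisors // => dt; have d0 := dvdn_gt0 t0 dt.
  have l0 : 0 < t %/ d by rewrite divn_gt0 // dvdn_leq.
  have := @card_power_words t d (t %/ d) d0 l0; rewrite divnK // leqnn subnn expn0 mul1n.
  move=> <- //; rewrite -sum1dep_card big_mkcond; apply: eq_bigr => u _.
  by case: asbool.
rewrite (eq_big_seq _ e) exchange_big /=.
rewrite -[k in RHS]card_ord -[t in RHS]card_ord -card_ffun -sum1_card.
apply: eq_bigr => u _.
have [c [hc pc ec]] : exists c, [/\ 0 < c <= t, primitive_suffix (letter u) t c & loop (letter u) t c = loop (letter u) t t].
  by apply: root_exists; rewrite t0 leqnn.
have ct : c %| t by apply: (primitive_suffix_dvd (s := letter u)) pc _; rewrite ?t0 ?leqnn.
rewrite (bigD1_seq c) ?divisors_uniq -?dvdn_divisors //=.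
rewrite asboolT // big1_seq // => d /andP[dc]; rewrite -dvdn_divisors // => dt.
rewrite asboolF // => -[pd ed]; case/eqP: dc.
have d0 := dvdn_gt0 t0 dt.
case: (ltngtP d c) => // lt.
  by case: (pc d); [lia|rewrite ec ed].
by case: (pd c); [lia|rewrite ec ed].
Qed.

Lemma psi_num_primitive t : 0 < t -> psi k t = (num_primitive t : int).
Proof.
move=> t0; apply: (@moebius_inversion (fun d => (num_primitive d : int))) => // d dt.
have d0 := dvdn_gt0 t0 dt.
rewrite -(big_morph Posz PoszD (erefl _)) sum_num_primitive //.
by rewrite -[LHS]natz natrX natz.
Qed.

End CountWords.

(** * Chains of letters and multisets *)

(** The number of multisets of size r with m types of elements.  The truncated
    predecessor gives the right value 0 for m = 0 and r > 0, and 1 for m = r =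
    0. *)
Definition multichoose m r := 'C((m + r).-1, r).
(** The number of chains for k letters with d strict steps, see [card_slots]. *)
Definition multichoose_from m d k := if d < k then multichoose m (k.-1 - d) else 0.

Lemma multichoose0 m : multichoose m 0 = 1. Proof. by rewrite /multichoose bin0. Qed.
Lemma multichoose_pascal m q : multichoose m.+1 q.+1 = multichoose m q.+1 + multichoose m.+1 q.
Proof. by rewrite /multichoose addSn !addnS addSn /= binS. Qed.

(** A step of a chain is an equality (None), a weak increase (Some false) or a
    strict increase (Some true). *)
Definition slot_rel (t : option bool) (a b : nat) :=
  if t is Some st then a + st <= b else a == b.

(** The letters f with the sentinels a and b at the ends. *)
Fixpoint chain (ts : seq (option bool)) (a : nat) (f : seq nat) (b : nat) : bool :=
  match ts, f with
  | [:: t], [::] => slot_rel t a b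
  | t :: ts', x :: f' => slot_rel t a x && chain ts' x f' b
  | _, _ => false
  end.

Lemma chainP ts a f b : size ts = (size f).+1 ->
  reflect (forall v, v <= size f ->
      slot_rel (nth None ts v) (nth 0 (a :: f) v) (nth b f v))
    (chain ts a f b).
Proof.
elim: f ts a => [|x f IH] [|t ts] a //=.
  case: ts => //= _; apply: (iffP idP) => [h [|v]//|h]; exact: (h 0).
case=> sz; have -> : (match ts with [::] => slot_rel t a x && chain ts x f b | _ :: _ => slot_rel t a x && chain ts x f b end) = (slot_rel t a x && chain ts x f b) by case: (ts).
apply: (iffP andP) => [[h0 /(IH _ _ sz) h] [|v]//|h].
  by rewrite ltnS => /h.
split; first exact: (h 0).
by apply/(IH _ _ sz) => v vs; apply: (h v.+1).
Qed.

Definition num_strict (ts : seq (option bool)) := count (pred1 (Some true)) ts.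
Definition num_equal (ts : seq (option bool)) := count (pred1 None) ts.

Section CountChains.
Variable k : nat.

(** The number of chains from a to b with m steps that are not equalities, of
    which d are strict: after the d compulsory increments, distribute b - a - d
    among the m steps. *)
Definition chain_count m d a b := if d + a <= b then multichoose m (b - a - d) else 0.

Lemma sum_chain_count m d a b : b < k ->
  \sum_(x < k | a <= x) chain_count m d x b = chain_count m.+1 d a b.
Proof.
move=> bk; have [n] := ubnP (b.+1 - a); elim: n a => // n IH a hn.
case: (leqP a b) => ab; last first.
  rewrite big1 /chain_count; first by rewrite ifF //; lia.
  by move=> x ax; rewrite ifF //; lia.
have ak : a < k by lia.
rewrite (bigD1 (Ordinal ak)) //=.
rewrite (eq_bigl (fun x : 'I_k => a.+1 <= x)); last first.
  move=> x; rewrite ltn_neqAle andbC; congr (_ && _).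
  by rewrite -val_eqE /= eq_sym.
rewrite IH; last lia.
rewrite /chain_count; case: (ltngtP (d + a) b) => h.
- rewrite ifT; last lia.
  have -> : b - a - d = (b - a.+1 - d).+1 by lia.
  by rewrite multichoose_pascal.
- by rewrite ifF //; lia.
- rewrite ifF; last lia.
  have -> : b - a - d = 0 by lia.
  by rewrite !multichoose0.
Qed.

Lemma card_chain n ts a b : size ts = n.+1 -> a < k -> b < k ->
  #|[set f : n.-tuple 'I_k | chain ts a (map val f) b]| =
  chain_count (n.+1 - num_equal ts) (num_strict ts) a b.
Proof.
have eq_to m d a' b' : a' < k -> b' < k ->
    \sum_(x < k | a' == x) chain_count m d x b' = chain_count m d a' b'.
  by move=> ak bk; rewrite (big_pred1 (Ordinal ak)) // => x; rewrite -val_eqE /= eq_sym.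
elim: n ts a => [|n IH] [|t ts] a //= [sz] ak bk.
  case: ts sz => // _; rewrite -sum1dep_card.
  rewrite (eq_bigl (fun _ => slot_rel t a b)); last by move=> f; rewrite tuple0.
  have -> : \sum_(f : 0.-tuple 'I_k | slot_rel t a b) 1 = slot_rel t a b.
    case: slot_rel; last by rewrite big_pred0.
    by rewrite (big_pred1 [tuple]) // => f; apply/esym/eqP/val_inj; rewrite /= (tuple0 f).
  rewrite /num_equal /num_strict /= !addn0 /chain_count.
  case: t => [[]|] /=.
  - rewrite addn1 add1n; case: ltnP => // h.
    by rewrite /multichoose subn0 add1n binn.
  - rewrite addn0 add0n; case: leqP => // h.
    by rewrite /multichoose subn0 add1n binn.
  - rewrite add0n subnn subn0; case: ltngtP => h //.
      by rewrite /multichoose add0n bin_small //; lia.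
    by rewrite h subnn multichoose0.
rewrite -sum1dep_card.
pose h (p : 'I_k * n.-tuple 'I_k) : n.+1.-tuple 'I_k := [tuple of p.1 :: p.2].
rewrite (reindex h); last first.
  exists (fun f : n.+1.-tuple 'I_k => (thead f, [tuple of behead f])).
    by move=> [x f] _; congr pair; apply: val_inj.
  by move=> f _; rewrite /h /= [RHS]tuple_eta; apply: val_inj.
have eqc (p : 'I_k * n.-tuple 'I_k) : chain (t :: ts) a (map val (h p)) b =
    slot_rel t a p.1 && chain ts p.1 (map val p.2) b by case: (ts) sz.
rewrite (eq_bigl _ _ eqc) -(pair_big_dep (fun x : 'I_k => slot_rel t a x)
   (fun (x : 'I_k) (f : n.-tuple 'I_k) => chain ts x (map val f) b) (fun _ _ => 1)) /=.
rewrite (eq_bigr (fun x : 'I_k => chain_count (n.+1 - num_equal ts) (num_strict ts) x b)); last first.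
  by move=> x _; rewrite sum1dep_card IH.
have le : num_equal ts <= n.+1 by rewrite -sz count_size.
case: t {eqc h} => [[]|] /=; rewrite /num_equal /num_strict /= -/(num_equal ts) -/(num_strict ts) ?add0n.
- rewrite (eq_bigl (fun x : 'I_k => a.+1 <= x)); last by move=> x; rewrite addn1.
  rewrite sum_chain_count // /chain_count -subSn // add1n addSnnS.
  by case: ifP => // _; congr multichoose; lia.
- rewrite (eq_bigl (fun x : 'I_k => a <= x)); last by move=> x; rewrite addn0.
  by rewrite sum_chain_count // -subSn.
- by rewrite eq_to // add1n subSS.
Qed.

End CountChains.

(** * Compatible prefixes of a given ranking as chains *)

Lemma sort_perm n r : ranking n.+1 r ->
  exists rho : 'S_n.+1, forall u v : 'I_n.+1, (r (rho u) < r (rho v)) = (u < v).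
Proof.
move=> rk.
have [||| r' [rk' e]] := @rank_of_order n (fun i j => r i < r j).
- by move=> i _; rewrite ltnn.
- by move=> i j l _ _ _; apply: ltn_trans.
- move=> i j iN jN ne; have := ranking_neq rk (leqW iN) (leqW jN) ne.
  by case: ltngtP.
have [tau et] := perm_of_ranking rk'.
have tauE (i : 'I_n.+1) : tau i = r' i :> nat by rewrite -et ?leq_ord // /rank_of inord_val.
exists (tau^-1)%g => u v.
by rewrite -(e _ _ (leq_ord _) (leq_ord _)) -!tauE !permKV.
Qed.

Section Slots.
Variables (n : nat) (r : nat -> nat).
Let N := n.+1.
Hypothesis rk : ranking N r.
Variable rho : 'S_n.+1.
Hypothesis rhoP : forall u v : 'I_n.+1, (r (rho u) < r (rho v)) = (u < v).

(** The index of the v-th smallest shift, the shift by N being left out. *)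
Definition by_rank (v : nat) : nat := rho (inord v).

Lemma by_rank_lt v : by_rank v < N. Proof. exact: ltn_ord. Qed.

Lemma by_rank_mono u v : u < N -> v < N -> (r (by_rank u) < r (by_rank v)) = (u < v).
Proof. by move=> uN vN; rewrite rhoP !inordK. Qed.

Lemma by_rank_onto i : i < N -> exists2 v, v < N & by_rank v = i.
Proof.
move=> iN; exists ((rho^-1)%g (Ordinal iN) : nat); first exact: ltn_ord.
by rewrite /by_rank inord_val permKV.
Qed.

Lemma by_rank_inj u v : u < N -> v < N -> by_rank u = by_rank v -> u = v.
Proof.
by move=> uN vN e; have := by_rank_mono uN vN; have := by_rank_mono vN uN; rewrite e ltnn; lia.
Qed.

Lemma by_rank_adjacent i j : i < N -> j < N -> r i < r j ->
  (forall l, l < N -> ~~ (r i < r l < r j)) ->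
  exists v, [/\ 0 < v < N, by_rank v.-1 = i & by_rank v = j].
Proof.
move=> /by_rank_onto[u uN <-] /by_rank_onto[v vN <-]; rewrite by_rank_mono // => uv gap.
have : ~~ (u.+1 < v).
  by apply/negP => h; have := gap (by_rank u.+1) (by_rank_lt _); rewrite !by_rank_mono; lia.
by move=> h; have -> : v = u.+1 by [lia]; exists u.+1; split=> //; lia.
Qed.

(** The N + 1 steps of the chain that consists of 0, the letters in the order of
    r, and k - 1.  An inner step must be strict if r increases from one
    successor to the next one.  The relation q selects inner steps that are
    forced to be equalities, and fe does it for the two outer steps. *)
Definition slot_type (q : rel nat) (fe : bool) (v : nat) : option bool :=
  if (v == 0) || (v == N) then (if fe then None else Some false)
  else if q (by_rank v.-1) (by_rank v) then None
  else Some (r (by_rank v.-1).+1 < r (by_rank v).+1).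

Definition slots q fe := mkseq (slot_type q fe) N.+1.

Definition num_ascents := num_strict (slots (fun _ _ => false) false).

Definition slot_cond (q : rel nat) (fe : bool) k (s : nat -> nat) :=
  [/\ compatible N r s,
      (forall v, 0 < v < N -> q (by_rank v.-1) (by_rank v) -> s (by_rank v.-1) = s (by_rank v)) &
      (fe -> s (by_rank 0) = 0 /\ s (by_rank n) = k.-1)].

(** Compatibility of consecutive shifts suffices: if two letters are equal, all
    letters in between are equal, and the descents add up. *)
Lemma compatible_of_slots s :
  (forall v, 0 < v < N -> s (by_rank v.-1) + (r (by_rank v.-1).+1 < r (by_rank v).+1) <= s (by_rank v)) ->
  compatible N r s.
Proof.
move=> h.
have step v : 0 < v < N -> s (by_rank v.-1) <= s (by_rank v) /\
    (s (by_rank v.-1) = s (by_rank v) -> r (by_rank v).+1 < r (by_rank v.-1).+1).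
  move=> hv; have h1 := h v hv; split; first lia.
  move=> e; have ne : (by_rank v.-1).+1 != (by_rank v).+1.
    by apply/eqP => -[] /by_rank_inj; lia.
  have := ranking_neq rk (by_rank_lt v.-1) (by_rank_lt v) ne; move: h1; rewrite e; case: ltngtP; lia.
move=> i j /by_rank_onto[u uN <-] /by_rank_onto[v vN <-]; rewrite by_rank_mono //.
elim: v vN => // v IH vN; rewrite ltnS leq_eqVlt => /orP[/eqP ->|uv].
  exact: (step v.+1).
have [a1 a2] := IH (ltnW vN) uv; have [b1 b2] : _ /\ _ := step v.+1 vN.
rewrite /= in b1 b2; split; first exact: leq_trans a1 b1.
move=> e; have e1 : s (by_rank u) = s (by_rank v) by lia.
by apply: ltn_trans (b2 _) (a2 e1); lia.
Qed.

Lemma slot_condP (q : rel nat) (fe : bool) k s : 0 < k -> (forall i, s i < k) ->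
  (forall v, 0 < v < N -> q (by_rank v.-1) (by_rank v) -> ~~ (r (by_rank v.-1).+1 < r (by_rank v).+1)) ->
  chain (slots q fe) 0 (mkseq (fun v => s (by_rank v)) N) k.-1 <-> slot_cond q fe k s.
Proof.
move=> k0 sk noasc.
have sz : size (slots q fe) = (size (mkseq (fun v => s (by_rank v)) N)).+1 by rewrite !size_mkseq.
have nthl v : v < N.+1 -> nth 0 (0 :: mkseq (fun v => s (by_rank v)) N) v = if v == 0 then 0 else s (by_rank v.-1).
  by case: v => // v vN; rewrite /= nth_mkseq.
have nthr v : v < N.+1 -> nth k.-1 (mkseq (fun v => s (by_rank v)) N) v = if v == N then k.-1 else s (by_rank v).
  move=> vN; case: eqP => [->|ne]; first by rewrite nth_default // size_mkseq.
  by rewrite nth_mkseq //; lia.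
split=> [/(chainP _ _ sz) h|[cp he hfe]].
  have h' v : v < N.+1 -> slot_rel (slot_type q fe v) (if v == 0 then 0 else s (by_rank v.-1))
     (if v == N then k.-1 else s (by_rank v)).
    move=> vN; have := h v; rewrite size_mkseq nthl // nthr // nth_mkseq //.
    by apply.
  split.
  - apply: compatible_of_slots => v hv; have := h' v; rewrite /slot_type.
    have [-> ->] : (v == 0) = false /\ (v == N) = false by lia.
    case: ifP => /= [ev|_]; last by apply; lia.
    move/(_ _)/eqP => -> //; last by lia.
    by rewrite (negbTE (noasc v hv ev)) addn0.
  - move=> v hv ev; have := h' v; rewrite /slot_type.
    have [-> ->] : (v == 0) = false /\ (v == N) = false by lia.
    by rewrite ev /= => h1; apply/eqP/h1; lia.
  - move=> f; have := h' 0 isT; have := h' N (ltnSn _); rewrite /slot_type !eqxx orbT f /=.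
    by move=> /eqP <- /eqP <-.
apply/(chainP _ _ sz) => v; rewrite size_mkseq => vN.
rewrite nthl // nthr // nth_mkseq // /slot_type.
case: (eqVneq v 0) => [->|v0] /=.
  by case f: fe => //=; have [-> _] := hfe f.
case: (eqVneq v N) => [->|vn] /=.
  case f: fe => //=; first by have [_ ->] := hfe f.
  by have := sk (by_rank n); lia.
have hv : 0 < v < N by lia.
case: ifP => [ev|_] /=; first by rewrite he.
have lt : r (by_rank v.-1) < r (by_rank v) by rewrite by_rank_mono; lia.
have [h1 h2] := cp _ _ (by_rank_lt _) (by_rank_lt _) lt.
case: ltnP => h3; rewrite ?addn0 // addn1 ltn_neqAle h1 andbT.
by apply/eqP => /h2; lia.
Qed.

Lemma card_slots (q : rel nat) (fe : bool) k : 0 < k ->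
  (forall v, 0 < v < N -> q (by_rank v.-1) (by_rank v) -> ~~ (r (by_rank v.-1).+1 < r (by_rank v).+1)) ->
  #|[set s : {ffun 'I_N -> 'I_k} | `[< slot_cond q fe k (letter s) >]]| =
  multichoose_from (N.+1 - num_equal (slots q fe)) (num_strict (slots q fe)) k.
Proof.
move=> k0 noasc.
have kk : k.-1 < k by rewrite prednK.
have := @card_chain k N (slots q fe) 0 k.-1 _ k0 kk; rewrite size_mkseq => /(_ (erefl _)).
rewrite /chain_count addn0 subn0 -[RHS]/(if _ then _ else _) /multichoose_from.
have -> : (num_strict (slots q fe) <= k.-1) = (num_strict (slots q fe) < k) by rewrite -ltnS prednK.
move=> <-; rewrite -!sum1dep_card.
pose h (s : {ffun 'I_N -> 'I_k}) : N.-tuple 'I_k := [tuple s (rho v) | v < N].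
pose g (f : N.-tuple 'I_k) : {ffun 'I_N -> 'I_k} := [ffun i => tnth f ((rho^-1)%g i)].
rewrite [RHS](reindex h); last first.
  exists g => [s _|f _].
    by apply/ffunP => i; rewrite ffunE tnth_mktuple permKV.
  by apply: eq_from_tnth => i; rewrite tnth_mktuple ffunE permK.
apply: eq_bigl => s.
have -> : map val (h s) = mkseq (fun v => letter s (by_rank v)) N.
  apply: (@eq_from_nth _ 0) => [|i]; first by rewrite size_map size_tuple size_mkseq.
  rewrite size_map size_tuple => iN; rewrite nth_mkseq //.
  rewrite (nth_map (Ordinal k0)) ?size_tuple //.
  rewrite -(tnth_nth _ _ (Ordinal iN)) tnth_mktuple.
  by rewrite letter_ord; congr (nat_of_ord (s (rho _))); apply: val_inj; rewrite /= inordK.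
have sk i : letter s i < k by apply: letter_lt.
by apply/asboolP/idP => /(slot_condP fe k0 sk noasc).
Qed.

Lemma num_strict_slots (q : rel nat) (fe : bool) :
  (forall v, 0 < v < N -> q (by_rank v.-1) (by_rank v) -> ~~ (r (by_rank v.-1).+1 < r (by_rank v).+1)) ->
  num_strict (slots q fe) = num_ascents.
Proof.
move=> noasc; rewrite /num_ascents /num_strict /slots /mkseq !count_map.
apply: eq_in_count => v; rewrite mem_iota add0n => /= vN.
rewrite /slot_type; case: (eqVneq v 0) => [_|v0] /=; first by case: fe.
case: (eqVneq v N) => [_|vn] /=; first by case: fe.
by case: ifP => // ev; rewrite (negbTE (noasc v _ ev)) //; lia.
Qed.

Lemma num_equal_slots (q : rel nat) (fe : bool) :
  num_equal (slots q fe) = #|[set v : 'I_N | (0 < v) && q (by_rank v.-1) (by_rank v)]| + fe.*2.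
Proof.
rewrite /num_equal /slots /mkseq count_map.
have -> : iota 0 N.+1 = rcons (0 :: iota 1 n) N.
  by rewrite -[N.+1]addn1 iotaD cats1.
rewrite -cats1 count_cat /= /slot_type !eqxx orbT /= addn0.
have -> : count (preim (slot_type q fe) (pred1 None)) (iota 1 n) =
    count (fun v => q (by_rank v.-1) (by_rank v)) (iota 1 n).
  apply: eq_in_count => v; rewrite mem_iota => hv /=; rewrite /slot_type.
  have [-> ->] : (v == 0) = false /\ (v == N) = false by lia.
  by case: ifP.
have -> : #|[set v : 'I_N | (0 < v) && q (by_rank v.-1) (by_rank v)]| = count (fun v => q (by_rank v.-1) (by_rank v)) (iota 1 n).
  rewrite -sum1dep_card -(big_mkord (fun v => (0 < v) && q (by_rank v.-1) (by_rank v)) (fun _ => 1)).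
  rewrite sum1_count /index_iota subn0.
  rewrite /= add0n; apply: eq_in_count => v; rewrite mem_iota.
  by case: v.
by case: fe => /=; lia.
Qed.

End Slots.

(** * Numbers of trapped prefixes of a given ranking *)

Lemma card_asbool_eq (T : finType) (P Q : T -> Prop) : (forall x, P x <-> Q x) ->
  #|[set x | `[< P x >]]| = #|[set x | `[< Q x >]]|.
Proof.
by move=> h; apply: eq_card => x; rewrite !inE; apply/asboolP/asboolP => /h.
Qed.

(** The indices i and j carry the same letter of the two copies of the block in
    a suffix of the form q q. *)
Definition paired N c : rel nat := fun i j =>
  ((j == i + c) && (N - 2 * c <= i < N - c)) || ((i == j + c) && (N - 2 * c <= j < N - c)).

Section Profile.
Variables (n : nat) (r : nat -> nat).
Let N := n.+1.
Hypotheses (n0 : 0 < n) (rk : ranking N r).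

(** The c pairs of a repeated block are disjoint and each pair is adjacent, so
    they occupy c different steps of the chain. *)
Lemma card_paired (rho : 'S_n.+1) c : (forall u v : 'I_n.+1, (r (rho u) < r (rho v)) = (u < v)) ->
  0 < c -> 2 * c <= N ->
  (forall i, i < c -> forall j, j < N ->
     ~~ (r (N - 2 * c + i) < r j < r (N - c + i)) /\
     ~~ (r (N - c + i) < r j < r (N - 2 * c + i))) ->
  (forall i, i < c -> exists v, [/\ 0 < v < N, paired N c (by_rank rho v.-1) (by_rank rho v) &
     (by_rank rho v.-1 = N - 2 * c + i /\ by_rank rho v = N - c + i) \/
     (by_rank rho v.-1 = N - c + i /\ by_rank rho v = N - 2 * c + i)]) /\
  #|[set v : 'I_N | (0 < v) && paired N c (by_rank rho v.-1) (by_rank rho v)]| = c.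
Proof.
move=> rhoP c0 c2 gap.
have ex i : i < c -> exists v, [/\ 0 < v < N, paired N c (by_rank rho v.-1) (by_rank rho v) &
     (by_rank rho v.-1 = N - 2 * c + i /\ by_rank rho v = N - c + i) \/
     (by_rank rho v.-1 = N - c + i /\ by_rank rho v = N - 2 * c + i)].
  move=> ic; have iN1 : N - 2 * c + i < N by lia.
  have iN2 : N - c + i < N by lia.
  have ne : N - 2 * c + i != N - c + i by lia.
  have := ranking_neq rk (ltnW iN1) (ltnW iN2) ne; case: ltngtP => // lt _.
    have [|v [hv e1 e2]] := by_rank_adjacent rhoP iN1 iN2 lt.
      by move=> l lN; case: (gap i ic l lN).
    exists v; split=> //; last by left.
    by rewrite e1 e2 /paired; lia.
  have [|v [hv e1 e2]] := by_rank_adjacent rhoP iN2 iN1 lt.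
    by move=> l lN; case: (gap i ic l lN).
  exists v; split=> //; last by right.
  by rewrite e1 e2 /paired; lia.
split=> //.
have ex' (i : 'I_c) : exists v : 'I_N, (0 < v) && paired N c (by_rank rho v.-1) (by_rank rho v) /\
     ((by_rank rho v.-1 = N - 2 * c + i /\ by_rank rho v = N - c + i) \/
     (by_rank rho v.-1 = N - c + i /\ by_rank rho v = N - 2 * c + i)).
  have [v [/andP[v0 vN] pv e]] := ex i (ltn_ord i).
  by exists (Ordinal vN); rewrite /= v0 pv.
have [f fP] := choice ex'.
have finj : injective f.
  move=> i j e; have [_ h1] := fP i; have [_ h2] := fP j; rewrite e in h1.
  by apply: val_inj => /=; have := ltn_ord i; have := ltn_ord j; lia.
rewrite -[RHS]card_ord -(card_imset _ finj); apply: eq_card => v; rewrite inE.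
apply/idP/imsetP => [/andP[v0 pv]|[i _ ->]]; last by case: (fP i).
have ulow : exists2 i, i < c &
     ((by_rank rho v.-1 = N - 2 * c + i /\ by_rank rho v = N - c + i) \/
     (by_rank rho v.-1 = N - c + i /\ by_rank rho v = N - 2 * c + i)).
  move: pv; rewrite /paired => /orP[] /andP[/eqP e h].
    by exists (by_rank rho v.-1 - (N - 2 * c)); [lia|left; lia].
  by exists (by_rank rho v - (N - 2 * c)); [lia|right; lia].
case: ulow => i ic e; exists (Ordinal ic) => //; apply: val_inj => /=.
have [/andP[w0 _] e'] := fP (Ordinal ic); rewrite /= in e'.
have inj := by_rank_inj rhoP; have vN := ltn_ord v; have wN := ltn_ord (f (Ordinal ic)).
have d : N - 2 * c + i <> N - c + i by lia.
have vN1 : v.-1 < n.+1 by lia.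
have wN1 : (f (Ordinal ic)).-1 < n.+1 by lia.
case: e => -[e1 e2]; case: e' => -[e1' e2'].
- by apply: inj => //; rewrite e2 e2'.
- have := inj _ _ vN1 wN; have := inj _ _ vN wN1; rewrite e1 e2 e1' e2'; lia.
- have := inj _ _ vN1 wN; have := inj _ _ vN wN1; rewrite e1 e2 e1' e2'; lia.
- by apply: inj => //; rewrite e2 e2'.
Qed.

(** Whether a word is trapped can be read from equalities in its chain, so one
    trapped word over one alphabet determines the number of trapped words over
    every alphabet. *)
Lemma slot_profile : exists d,
  [/\ forall k, 0 < k ->
        #|[set s : {ffun 'I_N -> 'I_k} | `[< compatible N r (letter s) >]]| = multichoose_from N.+1 d k,
      forall c s0, compatible N r s0 -> spiral N r s0 c -> forall k, 0 < k ->
        #|[set s : {ffun 'I_N -> 'I_k} | `[< compatible N r (letter s) /\ spiral N r (letter s) c >]]| =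
        multichoose_from (N.+1 - c) d k &
      forall k0 s0, (forall i, s0 i < k0) -> compatible N r s0 -> bottom_trap N k0 r s0 ->
        forall k, 0 < k ->
        #|[set s : {ffun 'I_N -> 'I_k} | `[< compatible N r (letter s) /\ bottom_trap N k r (letter s) >]]| =
        multichoose_from (N.+1 - 2) d k].
Proof.
have [rho rhoP] := sort_perm rk.
pose nq : rel nat := fun _ _ => false.
exists (num_ascents r rho); split.
- move=> k k0; rewrite -(num_strict_slots (q := nq) false) //.
  have -> : multichoose_from N.+1 (num_strict (slots r rho nq false)) k =
     multichoose_from (N.+1 - num_equal (slots r rho nq false)) (num_strict (slots r rho nq false)) k.
    rewrite num_equal_slots /= addn0 (eq_card0 (A := _)) ?subn0 // => v.
    by rewrite !inE /nq andbF.
  rewrite -(card_slots (q := nq) rk rhoP false k0) //; apply: card_asbool_eq => s.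
  by split=> [cp|[]//]; split.
- move=> c s0 cp0 o0 k k0; case: (o0) => oc c2 pc e2 h.
  have c0 : 0 < c by case: (c) oc.
  have gap i (ic : i < c) := spiral_pairs rk cp0 o0 ic.
  have [ex cd] := card_paired rhoP c0 c2 gap.
  have let0 i j : paired N c i j -> s0 i = s0 j.
    have lt i' : N - 2 * c <= i' -> i' + c < N -> s0 (i' + c) = s0 i'.
      exact: (loop_mul_letters c0 (ltn0Sn 1) c2 e2).
    by rewrite /paired => /orP[] /andP[/eqP -> h']; rewrite lt //; lia.
  have noasc v : 0 < v < N -> paired N c (by_rank rho v.-1) (by_rank rho v) ->
      ~~ (r (by_rank rho v.-1).+1 < r (by_rank rho v).+1).
    move=> hv /let0 e; rewrite -leqNgt; apply: ltnW.
    have lt : r (by_rank rho v.-1) < r (by_rank rho v) by rewrite (by_rank_mono rhoP); lia.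
    by case: (cp0 _ _ (by_rank_lt _ _) (by_rank_lt _ _) lt) => _ /(_ e).
  rewrite -(num_strict_slots (q := paired N c) false noasc).
  have -> : N.+1 - c = N.+1 - num_equal (slots r rho (paired N c) false).
    by rewrite num_equal_slots cd addn0.
  rewrite -(card_slots rk rhoP false k0 noasc); apply: card_asbool_eq => s; split.
    case=> cp [_ _ _ e2' _]; split=> // v hv.
    have lt i' : N - 2 * c <= i' -> i' + c < N -> letter s (i' + c) = letter s i'.
      exact: (loop_mul_letters c0 (ltn0Sn 1) c2 e2').
    by rewrite /paired => /orP[] /andP[/eqP -> h']; rewrite lt //; lia.
  case=> cp eqs _; split=> //; apply: (spiral_of_gap rk cp) => //.
    move=> i ic; have [v [hv pv [[e1 e1']|[e1 e1']]]] := ex i ic;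
      have := eqs v hv pv; rewrite e1 e1' //.
  by move=> j jN; apply: (spiral_gap rk cp0 o0).
- move=> k1 s0 sk0 cp0 b0 k k0.
  have [mx mn] := bottom_trap_extreme (n0 : 1 < N) cp0 sk0 b0.
  have noasc v : 0 < v < N -> nq (by_rank rho v.-1) (by_rank rho v) ->
      ~~ (r (by_rank rho v.-1).+1 < r (by_rank rho v).+1) by [].
  rewrite -(num_strict_slots (q := nq) true noasc).
  have -> : N.+1 - 2 = N.+1 - num_equal (slots r rho nq true).
    rewrite num_equal_slots (eq_card0 (A := _)) // => v.
    by rewrite !inE /nq andbF.
  have p0 : by_rank rho 0 = N - 2.
    have lt : N - 2 < N by lia.
    have [v vN ev] := by_rank_onto rho lt.
    have := mn _ (by_rank_lt rho 0); rewrite -ev; case: (posnP v) => [->//|v0].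
    have := by_rank_mono rhoP (ltn0Sn n) vN; rewrite v0; lia.
  have pn : by_rank rho n = N - 1.
    have lt : N - 1 < N by lia.
    have [v vN ev] := by_rank_onto rho lt.
    have := mx _ (by_rank_lt rho n); rewrite -ev; case: (ltngtP v n) => [vn|nv|->//].
      have := by_rank_mono rhoP vN (ltnSn n); rewrite vn; lia.
    by lia.
  rewrite -(card_slots rk rhoP true k0 noasc); apply: card_asbool_eq => s; split.
    by case=> cp [_ h1 h2]; split=> // _; rewrite p0 pn.
  case=> cp _ /(_ isT); rewrite p0 pn => -[h1 h2]; split=> //; split=> //.
  by case: b0.
Qed.

End Profile.

(** * Realizable permutations *)

Lemma loop_eq_word N s s' t : (forall i, i < N -> s i = s' i) -> 0 < t <= N -> loop s N t = loop s' N t.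
Proof.
move=> e ht; apply/funext => m; apply: e.
have : m %% t < t by rewrite ltn_mod; lia.
lia.
Qed.

Lemma compatible_eq_word N r s s' : (forall i, i < N -> s i = s' i) -> compatible N r s -> compatible N r s'.
Proof. by move=> e cp i j iN jN; rewrite -!e //; apply: cp. Qed.

Lemma primitive_suffix_eq_word N s s' c : (forall i, i < N -> s i = s' i) -> 0 < c <= N -> primitive_suffix s N c -> primitive_suffix s' N c.
Proof. by move=> e hc h d hd; rewrite -!(loop_eq_word e) //; [apply: h|lia]. Qed.

Lemma spiral_eq_word N r s s' c : (forall i, i < N -> s i = s' i) -> spiral N r s c -> spiral N r s' c.
Proof.
move=> e [oc c2 pc e2 h]; have c0 : 0 < c by case: (c) oc.
by split=> //; [apply: primitive_suffix_eq_word pc => //; lia|rewrite -!(loop_eq_word e) //; lia].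
Qed.

Lemma spiral_rev_eq_word N r s s' c : (forall i, i < N -> s i = s' i) -> spiral_rev N r s c -> spiral_rev N r s' c.
Proof.
move=> e [oc c2 pc e2 h]; have c0 : 0 < c by case: (c) oc.
by split=> //; [apply: primitive_suffix_eq_word pc => //; lia|rewrite -!(loop_eq_word e) //; lia].
Qed.

Lemma bottom_trap_eq_word N k r s s' : 1 < N -> (forall i, i < N -> s i = s' i) ->
  bottom_trap N k r s -> bottom_trap N k r s'.
Proof. by move=> N2 e [h a b]; split=> //; rewrite -e //; lia. Qed.
Lemma top_trap_eq_word N k r s s' : 1 < N -> (forall i, i < N -> s i = s' i) ->
  top_trap N k r s -> top_trap N k r s'.
Proof. by move=> N2 e [h a b]; split=> //; rewrite -e //; lia. Qed.

Lemma bottom_trap_eq_rank N k r r' s : (forall i, i <= N -> r i = r' i) -> bottom_trap N k r s -> bottom_trap N k r' s.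
Proof. by move=> e [h a b]; split=> // i iN; rewrite -!e ?h //; lia. Qed.

Section Finite.
Variable N : nat.

Definition rperm : 'S_N.+1 := perm (@rev_ord_inj N.+1).
Definition mirror_perm (o : bool) (pi : 'S_N.+1) : 'S_N.+1 := if o then (pi * rperm)%g else pi.
Definition mirror_word k (o : bool) (s : {ffun 'I_N -> 'I_k}) : {ffun 'I_N -> 'I_k} :=
  if o then [ffun i => rev_ord (s i)] else s.

Lemma rank_of_mirror_perm pi i : i <= N -> rank_of (mirror_perm true pi) i = N - rank_of pi i.
Proof. by move=> iN; rewrite /rank_of /= permM permE /= subSS. Qed.

Lemma letter_mirror_word k (s : {ffun 'I_N -> 'I_k}) i : i < N -> letter (mirror_word true s) i = k.-1 - letter s i.
Proof.
move=> iN; have := letter_ord (mirror_word true s) (Ordinal iN); have := letter_ord s (Ordinal iN).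
by rewrite /= => -> ->; rewrite ffunE /=; lia.
Qed.

Lemma mirror_perm_inv o : involutive (mirror_perm o).
Proof.
case: o => pi //=; apply/permP => i; rewrite !permM !permE; exact: rev_ordK.
Qed.

Lemma mirror_word_inv k o : involutive (@mirror_word k o).
Proof.
case: o => s //=; apply/ffunP => i; rewrite !ffunE; exact: rev_ordK.
Qed.

(** The kinds of traps, up to the mirror symmetry: [None] stands for the bottom
    trap. *)
Definition trap k (tau : option 'I_N.+1) (r s : nat -> nat) : Prop :=
  if tau is Some c then spiral N r s c else bottom_trap N k r s.

Lemma mirror_compatible_fin k (pi : 'S_N.+1) (s : {ffun 'I_N -> 'I_k}) : 0 < k ->
  compatible N (rank_of pi) (letter s) -> compatible N (rank_of (mirror_perm true pi)) (letter (mirror_word true s)).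
Proof.
move=> k0 cp; have sk i : letter s i < k by apply: letter_lt.
have c1 := mirror_compatible (rank_of_ranking pi) sk cp.
have c2 : compatible N (rank_of (mirror_perm true pi)) (fun i => k.-1 - letter s i).
  by apply: compatible_eq_rank c1 => i iN; rewrite rank_of_mirror_perm.
by apply: compatible_eq_word c2 => i iN; rewrite letter_mirror_word.
Qed.

Lemma mirror_compatible_finE k o (pi : 'S_N.+1) (s : {ffun 'I_N -> 'I_k}) : 0 < k ->
  compatible N (rank_of pi) (letter s) <-> compatible N (rank_of (mirror_perm o pi)) (letter (mirror_word o s)).
Proof.
case: o => // k0; split; first exact: mirror_compatible_fin.
move/(mirror_compatible_fin k0).
by rewrite (mirror_perm_inv true) (mirror_word_inv true).
Qed.

Lemma mirror_spiral_fin k (pi : 'S_N.+1) (s : {ffun 'I_N -> 'I_k}) c : 0 < k ->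
  spiral_rev N (rank_of pi) (letter s) c <-> spiral N (rank_of (mirror_perm true pi)) (letter (mirror_word true s)) c.
Proof.
move=> k0; have sk i : letter s i < k by apply: letter_lt.
rewrite (mirror_spiral (rank_of_ranking pi) sk); split=> h.
  apply: (@spiral_eq_word _ _ (fun i => k.-1 - letter s i)); first by move=> i /letter_mirror_word ->.
  by apply: spiral_eq_rank h => i iN; rewrite rank_of_mirror_perm.
apply: (@spiral_eq_word _ _ (letter (mirror_word true s))); first by move=> i /letter_mirror_word ->.
by apply: spiral_eq_rank h => i iN; rewrite rank_of_mirror_perm.
Qed.

Lemma mirror_top_fin k (pi : 'S_N.+1) (s : {ffun 'I_N -> 'I_k}) : 1 < N -> 0 < k ->
  top_trap N k (rank_of pi) (letter s) <-> bottom_trap N k (rank_of (mirror_perm true pi)) (letter (mirror_word true s)).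
Proof.
move=> N2 k0; have sk i : letter s i < k by apply: letter_lt.
rewrite (mirror_top (rank_of_ranking pi) sk N2); split=> h.
  apply: (@bottom_trap_eq_word _ _ _ (fun i => k.-1 - letter s i)) => //; first by move=> i /letter_mirror_word ->.
  by apply: bottom_trap_eq_rank h => i iN; rewrite rank_of_mirror_perm.
apply: (@bottom_trap_eq_word _ _ _ (letter (mirror_word true s))) => //; first by move=> i /letter_mirror_word ->.
by apply: bottom_trap_eq_rank h => i iN; rewrite rank_of_mirror_perm.
Qed.

End Finite.

Definition nat_word k (w : word k) : nat -> nat := fun i => w i.

Lemma iter_shift k (w : word k) i : iter i (@shift k) w = fun m => w (i + m).
Proof.
elim: i => [|i IH] /=; first by [].
by rewrite IH; apply/funext => m; rewrite /shift addnS addSn.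
Qed.

Lemma word_ltE k (v w : word k) : word_lt v w <-> alt_lt (nat_word v) (nat_word w).
Proof.
have sgn (j a b : nat) : ((0 < (-1) ^+ j * (b%:Z - a%:Z))%R) = (if odd j then b < a else a < b).
  by rewrite -GRing.signr_odd; case: odd; rewrite /= ?GRing.expr1 ?GRing.expr0; lia.
split=> -[j [eqj dj]]; exists j; split.
- by move=> i /eqj; rewrite /nat_word => ->.
- by move: dj; rewrite sgn.
- by move=> i /eqj /val_inj.
- by rewrite sgn.
Qed.

Section Allowed.
Variables (N k : nat) (pi : 'S_N.+1).
Hypotheses (N2 : 1 < N) (k0 : 0 < k).

(** A prefix is completed to a word that realizes pi exactly when it is
    compatible and not trapped. *)
Lemma allowedP : allowed k pi <->
  exists s : {ffun 'I_N -> 'I_k}, compatible N (rank_of pi) (letter s) /\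
    forall o (tau : option 'I_N.+1), ~ trap k tau (rank_of (mirror_perm o pi)) (letter (mirror_word o s)).
Proof.
have rk := rank_of_ranking pi; split.
  case=> w [_ h].
  have h' i j : i <= N -> j <= N -> rank_of pi i < rank_of pi j <-> alt_lt (tail (nat_word w) i) (tail (nat_word w) j).
    move=> iN jN; have := h (inord i) (inord j); rewrite !inordK ?ltnS // !iter_shift.
    by rewrite word_ltE.
  have wk i : nat_word w i < k by exact: ltn_ord.
  have cp := realized_compatible h'.
  have [no nb nt] := realized_good h' N2 wk.
  pose s : {ffun 'I_N -> 'I_k} := [ffun i : 'I_N => w i].
  have es i : i < N -> letter s i = nat_word w i.
    by move=> iN; have := letter_ord s (Ordinal iN); rewrite /= ffunE.
  have es' i : i < N -> nat_word w i = letter s i by move/es.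
  exists s; split; first exact: compatible_eq_word cp.
  case=> -[c|] /=.
  - by move/(mirror_spiral_fin _ _ _ k0)/(spiral_rev_eq_word es); case: (no c).
  - by move/(mirror_top_fin _ _ N2 k0)/(top_trap_eq_word N2 es).
  - by move/(spiral_eq_word es); case: (no c).
  - by move/(bottom_trap_eq_word N2 es).
case=> s [cp nbad].
have sk i : letter s i < k by apply: letter_lt.
have lec c : odd c -> 2 * c <= N -> c < N.+1 by lia.
have no : spiral_free N (rank_of pi) (letter s).
  move=> c; split=> o; have [oc c2 _ _ _] := o.
    by case: (nbad false (Some (Ordinal (lec _ oc c2)))).
  case: (nbad true (Some (Ordinal (lec _ oc c2)))).
  by apply/(mirror_spiral_fin _ _ _ k0).
have nb : ~ bottom_trap N k (rank_of pi) (letter s) by exact: (nbad false None).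
have nt : ~ top_trap N k (rank_of pi) (letter s).
  by move/(mirror_top_fin _ _ N2 k0); exact: (nbad true None).
have [w [wk ws wr]] := realize N2 rk cp sk no nb nt.
pose w' : word k := fun i => Ordinal (wk i).
have key (i j : 'I_N.+1) : (pi i < pi j) <-> word_lt (iter i (@shift k) w') (iter j (@shift k) w').
  rewrite word_ltE !iter_shift; have := wr i j (leq_ord i) (leq_ord j).
  by rewrite /rank_of !inord_val.
exists w'; split=> // i j e; apply: contrapT => ne.
have : pi i != pi j by apply/eqP => /perm_inj.
have e' : iter i (@shift k) w' = iter j (@shift k) w' := e.
by rewrite -val_eqE /=; case: ltngtP => // /key; rewrite e' word_ltE => /alt_lt_irr.
Qed.

End Allowed.

(** * The weight of a permutation *)

Lemma multichoose0n q : multichoose 0 q = (q == 0).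
Proof. by case: q => // q; rewrite /multichoose add0n /= bin_small. Qed.

(** Multisets with a + b types are split according to the number of elements of
    the last b types. *)
Lemma multichoose_conv a b q : \sum_(j < q.+1) multichoose a (q - j) * multichoose b j = multichoose (a + b) q.
Proof.
elim: a q => [|a IHa] q.
  rewrite big_ord_recr /= subnn multichoose0 mul1n big1 // => j _.
  by rewrite multichoose0n subn_eq0 leqNgt ltn_ord.
elim: q => [|q IHq]; first by rewrite big_ord1 subnn !multichoose0.
rewrite big_ord_recr /= subnn multichoose0 mul1n.
rewrite (eq_bigr (fun j : 'I_q.+1 => multichoose a (q.+1 - j) * multichoose b j + multichoose a.+1 (q - j) * multichoose b j)); last first.
  by move=> j _; rewrite subSn ?leq_ord // multichoose_pascal mulnDl.
rewrite big_split /= IHq addSn multichoose_pascal -IHa [in RHS]big_ord_recr /= subnn multichoose0 mul1n.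
by rewrite addnAC.
Qed.

Lemma multichoose_from_conv a b d k :
  \sum_(1 <= j < k.+1) multichoose a (k - j) * multichoose_from b d j = multichoose_from (a + b) d k.
Proof.
case: (ltnP d k) => dk; last first.
  rewrite /multichoose_from [RHS]ifF; last lia.
  by rewrite big_nat big1 // => j hj; rewrite ifF ?muln0; lia.
rewrite (big_cat_nat_idem _ (n := d.+1)) //=; last lia.
rewrite big_nat big1 ?add0n; last by move=> j hj; rewrite /multichoose_from ifF ?muln0; lia.
rewrite -{1}[d.+1]add0n big_addn.
have -> : k.+1 - d.+1 = (k.-1 - d).+1 by lia.
rewrite /multichoose_from dk big_mkord -multichoose_conv; apply: eq_bigr => j _.
rewrite ifT; last lia.
have -> : k - (j + d.+1) = k.-1 - d - j by lia.
by have -> : (j + d.+1).-1 - d = j by lia.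
Qed.

Lemma multichoose_from_gt0 m d k : (0 < multichoose_from m.+1 d k) = (d < k).
Proof. by rewrite /multichoose_from; case: ifP => // _; rewrite /multichoose bin_gt0 addSn /= leq_addl. Qed.

Section PerPerm.
Variable m : nat.
Let N := m.+2.
Let T := (bool * option 'I_N.+1)%type.

(** The Boolean of the kind tells whether the trap occurs in the mirror
    image. *)
Definition trap_words k (tau : T) (pi : 'S_N.+1) :=
  [set s : {ffun 'I_N -> 'I_k} | `[< compatible N (rank_of pi) (letter s) /\
     trap k tau.2 (rank_of (mirror_perm tau.1 pi)) (letter (mirror_word tau.1 s)) >]].
Definition compatible_words k (pi : 'S_N.+1) :=
  [set s : {ffun 'I_N -> 'I_k} | `[< compatible N (rank_of pi) (letter s) >]].
(** The number of steps of a chain that a trap turns into equalities. *)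
Definition width (tau : T) : nat := if tau.2 is Some c then c : nat else 2.

Lemma card_trap_words_mirror k o tau pi : 0 < k ->
  #|trap_words k (o, tau) pi| = #|trap_words k (false, tau) (mirror_perm o pi)|.
Proof.
move=> k0; rewrite -[RHS](card_preimset _ (inv_inj (@mirror_word_inv N k o))); apply: eq_card => s.
by rewrite !inE /=; apply/asboolP/asboolP => -[h1 h2]; split=> //;
  apply/(mirror_compatible_finE o pi s k0).
Qed.

Lemma card_compatible_words_mirror k o pi : 0 < k -> #|compatible_words k pi| = #|compatible_words k (mirror_perm o pi)|.
Proof.
move=> k0; rewrite -[RHS](card_preimset _ (inv_inj (@mirror_word_inv N k o))); apply: eq_card => s.
by rewrite !inE /=; apply/asboolP/asboolP => h; apply/(mirror_compatible_finE o pi s k0).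
Qed.

(** The traces of a trap in the permutation alone, without reference to the word
    or its alphabet. *)
Lemma trap_shape k (tau : T) pi s : 0 < k -> s \in trap_words k tau pi ->
  match tau.2 with
  | Some c => [/\ odd c, 2 * c <= N &
      let lo := if tau.1 then N - 2 * c else N - c in
      let hi := if tau.1 then N - c else N - 2 * c in
      rank_of pi lo < rank_of pi N < rank_of pi hi /\
      forall j, j < N -> ~~ (rank_of pi lo < rank_of pi j < rank_of pi hi)]
  | None => forall i, i < N -> if tau.1 then rank_of pi i < rank_of pi N else rank_of pi N < rank_of pi i
  end.
Proof.
move=> k0; rewrite inE => /asboolP[cp].
have rN i : i <= N -> rank_of pi i <= N by exact: (proj1 (rank_of_ranking pi)).
case: tau => o [c|] /= b.
  have cp' := proj1 (mirror_compatible_finE o pi s k0) cp.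
  have gap := spiral_gap (rank_of_ranking _) cp' b.
  case: b => oc c2 _ _ h; split=> //; have c0 : 0 < c by case: (nat_of_ord c) oc.
  case: o gap h {cp'} => // gap h.
  have h1 := rank_of_mirror_perm pi (leqnn N).
  have h2 := @rank_of_mirror_perm N pi (N - c) (leq_subr _ _).
  have h3 := @rank_of_mirror_perm N pi (N - 2 * c) (leq_subr _ _).
  have r1 := rN N (leqnn _); have r2 := rN (N - c) (leq_subr _ _).
  have r3 := rN (N - 2 * c) (leq_subr _ _).
  split; first by move: h; rewrite h1 h2 h3; lia.
  move=> j jN; have := gap j jN; have rj := rN j (ltnW jN).
  by rewrite (rank_of_mirror_perm pi (ltnW jN)) h2 h3; lia.
case: b => h _ _ i iN; have := h i iN; case: o {h} => //.
have := rN i (ltnW iN); have := rN N (leqnn _).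
by rewrite (rank_of_mirror_perm pi (ltnW iN)) (rank_of_mirror_perm pi (leqnn N)); lia.
Qed.

(** An extreme N has no neighbours on both sides.  In a spiral the neighbours of
    N determine c and the orientation: from the mirror orientation one would get
    that an odd c is twice an integer. *)
Lemma trap_unique k1 k2 (tau1 tau2 : T) pi s1 s2 : 0 < k1 -> 0 < k2 ->
  s1 \in trap_words k1 tau1 pi -> s2 \in trap_words k2 tau2 pi -> tau1 = tau2.
Proof.
move=> k10 k20 /(trap_shape k10) b1 /(trap_shape k20) b2.
have inj i j : i <= N -> j <= N -> rank_of pi i = rank_of pi j -> i = j.
  exact: (proj2 (rank_of_ranking pi)).
have lt0 (c : nat) : odd c -> 2 * c <= N -> [/\ N - c < N, N - 2 * c < N & c <= N].
  by case: c => // c _ h; split; lia.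
case: tau1 tau2 b1 b2 => o1 [c1|] [o2 [c2|]] /=; last first.
- by move=> /(_ 0 isT) h1 /(_ 0 isT); case: o1 o2 h1 => -[] //; lia.
- move=> b1 [oc c2N [h _]]; have [q1 q2 _] := lt0 _ oc c2N.
  by have := b1 _ q1; have := b1 _ q2; move: h; case: o1 {b1}; case: o2; lia.
- move=> [oc c2N [h _]] b1; have [q1 q2 _] := lt0 _ oc c2N.
  by have := b1 _ q1; have := b1 _ q2; move: h; case: o1; case: o2 {b1}; lia.
move=> [oc1 l1 [h1 g1]] [oc2 l2 [h2 g2]].
have [q1 q2 q3] := lt0 _ oc1 l1; have [p1 p2 p3] := lt0 _ oc2 l2.
have eqlo a b a' b' : a < N -> b < N -> a' < N -> b' < N ->
    rank_of pi a < rank_of pi N < rank_of pi b -> (forall j, j < N -> ~~ (rank_of pi a < rank_of pi j < rank_of pi b)) ->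
    rank_of pi a' < rank_of pi N < rank_of pi b' -> (forall j, j < N -> ~~ (rank_of pi a' < rank_of pi j < rank_of pi b')) ->
    a = a'.
  move=> aN bN aN' bN' h g h' g'; apply: inj; [exact: ltnW|exact: ltnW|].
  by have := g _ aN'; have := g' _ aN; lia.
have := eqlo _ _ _ _ _ _ _ _ h1 g1 h2 g2.
case: o1 o2 {h1 g1 h2 g2} => -[] /= e.
- by congr (_, Some _); apply: val_inj => /=; have := e q2 q1 p2 p1; lia.
- have := e q2 q1 p1 p2; have : nat_of_ord c2 <> 2 * c1.
    by move=> e2; move: oc2; rewrite e2 oddM.
  lia.
- have := e q1 q2 p2 p1; have : nat_of_ord c1 <> 2 * c2.
    by move=> e2; move: oc1; rewrite e2 oddM.
  lia.
- by congr (_, Some _); apply: val_inj => /=; have := e q1 q2 p1 p2; lia.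
Qed.

Lemma width_bounds k (tau : T) pi s : 0 < k -> s \in trap_words k tau pi -> 0 < width tau <= N.
Proof.
move=> k0 /(trap_shape k0); case: tau => o [c|] //= [oc c2 _]; rewrite /width /=.
by case: (nat_of_ord c) oc c2 => // c' _; lia.
Qed.

(** The mirror image of pi has the same number of compatible words for every k,
    so the same number d of strict steps. *)
Lemma perm_profile pi : exists d,
  (forall k, 0 < k -> #|compatible_words k pi| = multichoose_from N.+1 d k) /\
  (forall k0 (tau : T), 0 < k0 -> trap_words k0 tau pi != set0 -> forall k, 0 < k ->
     #|trap_words k tau pi| = multichoose_from (N.+1 - width tau) d k).
Proof.
have prof (sigma : 'S_N.+1) : exists d,
  (forall k, 0 < k -> #|compatible_words k sigma| = multichoose_from N.+1 d k) /\
  (forall k0 tau, 0 < k0 -> trap_words k0 (false, tau) sigma != set0 -> forall k, 0 < k ->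
     #|trap_words k (false, tau) sigma| = multichoose_from (N.+1 - width (false, tau)) d k).
  have [d [h1 h2 h3]] := slot_profile (ltn0Sn m) (rank_of_ranking sigma).
  exists d; split=> // k0 tau k00 /set0Pn[s0]; rewrite inE => /asboolP[cp0 b0] k kk.
  case: tau b0 => [c|] b0; first exact: (h2 c (letter s0) cp0 b0 k kk).
  exact: (h3 k0 (letter s0) (fun i => letter_lt s0 i k00) cp0 b0 k kk).
have [d [h1 h2]] := prof pi; have [d' [h1' h2']] := prof (mirror_perm true pi).
have dd : d = d'.
  have e k : 0 < k -> (d < k) = (d' < k).
    by move=> kk; rewrite -(multichoose_from_gt0 N d) -h1 // (card_compatible_words_mirror true) // h1' // multichoose_from_gt0.
  by have := e d.+1 isT; have := e d'.+1 isT; lia.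
exists d; split=> // k0 [[] tau] k00 ne k kk; last exact: (h2 k0).
rewrite card_trap_words_mirror // dd; apply: (h2' k0) => //.
by rewrite -card_gt0 -card_trap_words_mirror // card_gt0.
Qed.

Lemma allowed_trap_words k pi : 0 < k -> allowed k pi <->
  exists2 s, s \in compatible_words k pi & forall tau : T, s \notin trap_words k tau pi.
Proof.
move=> k0; have aP := @allowedP N k pi isT k0; split.
  case/aP=> s [cp h]; exists s; first by rewrite inE; apply/asboolP.
  by move=> [o tau]; rewrite inE; apply/asboolP => -[_ /h].
case=> s; rewrite inE => /asboolP cp h; apply/aP; exists s; split=> // o tau b.
by have := h (o, tau); rewrite inE => /asboolP; apply.
Qed.

(** Over one letter all shifts are equal.  This matters for the minimum over k
    >= 2: a permutation with d = 0 cannot be realized with d + 1 letters. *)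
Lemma allowed1 pi : ~ @allowed N.+1 1 pi.
Proof.
case=> w [inj _]; have : ord0 = ord_max :> 'I_N.+1.
  by apply: inj; apply/funext => i; rewrite !ord1.
by move/(congr1 val).
Qed.

(** If pi has a trap of width w, all compatible words over d + 1 letters are
    trapped, but not all over d + 2 letters, so Nbar pi = d + 2.  Then the sum
    over j is the number of multisets with n - 1 types by
    [multichoose_from_conv], and the claim is Pascal's rule.  Without traps Nbar
    pi = d + 1 and the sum is empty. *)
Lemma perm_identity pi k : 0 < k -> 2 <= Nbar pi /\
  (if Nbar pi <= k then multichoose N.+1 (k - Nbar pi) else 0) +
  \sum_(tau : T) \sum_(1 <= j < k.+1) multichoose (width tau).-1 (k - j) * #|trap_words j tau pi| =
  #|compatible_words k pi|.
Proof.
move=> k0; have [d [hc hb]] := perm_profile pi.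
case: (pselect (exists k1 (tau : T), 0 < k1 /\ trap_words k1 tau pi != set0)); last first.
  move=> nex.
  have e0 j tau : 0 < j -> trap_words j tau pi = set0.
    by move=> j0; apply/eqP; apply: contraT => ne; case: nex; exists j, tau.
  have al j : 0 < j -> allowed j pi <-> d < j.
    move=> j0; rewrite allowed_trap_words // -(multichoose_from_gt0 N) -hc // card_gt0.
    split=> [[s hs _]|/set0Pn[s hs]]; first by apply/set0Pn; exists s.
    by exists s => // tau; rewrite e0 ?inE.
  have d1 : 1 < d.+1.
    by rewrite ltnS lt0n; apply/negP => /eqP d0; apply: (@allowed1 pi); apply/al; rewrite ?d0.
  have Nb : Nbar pi = d.+1.
    apply/NbarP => //; split; first exact/al.
    by move=> k' h1 h2 /al; lia.
  rewrite Nb hc //; split=> //.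
  rewrite big1 ?addn0; last first.
    move=> tau _; rewrite big_nat big1 // => j /andP[j0 _].
    by rewrite e0 // cards0 muln0.
  by rewrite /multichoose_from; case: ifP => // dk; congr multichoose; lia.
case=> k1 [tau [k10 ne]].
have [s1 hs1] := set0Pn _ ne.
have wd := width_bounds k10 hs1.
have hb' := hb k1 tau k10 ne.
have e0 j tau' : 0 < j -> tau' != tau -> trap_words j tau' pi = set0.
  move=> j0 nt; apply/eqP; apply: contraT => /set0Pn[s hs].
  by rewrite (trap_unique j0 k10 hs hs1) eqxx in nt.
have trap_tail j : trap_words j tau pi \subset compatible_words j pi.
  by apply/subsetP => s; rewrite !inE => /asboolP[h _]; apply/asboolP.
have al j : 0 < j -> allowed j pi <-> #|trap_words j tau pi| < #|compatible_words j pi|.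
  move=> j0; rewrite allowed_trap_words //; split.
    case=> s hs h; apply: proper_card; apply/properP; split=> //; exists s => //.
  move=> lt; have : trap_words j tau pi \proper compatible_words j pi by rewrite properEcard trap_tail.
  case/properP => _ [s hs hn]; exists s => // tau'.
  by case: (eqVneq tau' tau) => [->//|nt]; rewrite e0 ?inE.
have Nb : Nbar pi = d.+2.
  apply/NbarP => //; split.
    apply/al => //; rewrite hb' // hc // /multichoose_from !ifT // /=.
    have -> : d.+1 - d = 1 by lia.
    by rewrite /multichoose !addn1 /= !bin1; lia.
  move=> k' h1 h2; have k'0 : 0 < k' by lia.
  move/(al k' k'0); rewrite hb' // hc // /multichoose_from; case: ifP => // dk'.
  have -> : k'.-1 - d = 0 by lia.
  by rewrite !multichoose0.
rewrite Nb; split=> //; rewrite hc // (bigD1 tau) //= [X in _ + (_ + X)]big1 ?addn0; last first.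
  move=> tau' nt; rewrite big_nat big1 // => j /andP[j0 _].
  by rewrite e0 // cards0 muln0.
rewrite (eq_big_nat _ _ (F2 := fun j => multichoose (width tau).-1 (k - j) * multichoose_from (N.+1 - width tau) d j)); last first.
  by move=> j /andP[j0 _]; rewrite hb'.
rewrite multichoose_from_conv.
have -> : (width tau).-1 + (N.+1 - width tau) = N by lia.
rewrite /multichoose_from; case: (ltngtP d.+1 k) => dk /=.
- have -> : k.-1 - d = (k - d.+2).+1 by lia.
  by rewrite multichoose_pascal addnC.
- by [].
- have -> : k.-1 - d = 0 by lia.
  by rewrite !multichoose0.
Qed.

End PerPerm.

(** * Summation over all permutations *)

Lemma sum_card_swap (A B : finType) (R : A -> B -> bool) :
  \sum_(x : A) #|[set y | R x y]| = \sum_(y : B) #|[set x | R x y]|.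
Proof.
transitivity (\sum_(x : A) \sum_(y : B) (R x y : nat)).
  by apply: eq_bigr => x _; rewrite -sum1dep_card big_mkcond; apply: eq_bigr => y _; case: (R x y).
rewrite exchange_big; apply: eq_bigr => y _.
by rewrite -sum1dep_card [RHS]big_mkcond; apply: eq_bigr => x _; case: (R x y).
Qed.

Lemma sum_asbool (A : finType) (P : A -> Prop) :
  \sum_(x : A) (`[< P x >] : nat) = #|[set x | `[< P x >]]|.
Proof. by rewrite -sum1dep_card [RHS]big_mkcond; apply: eq_bigr => x _; case: asbool. Qed.

Section Totals.
Variable m : nat.
Let N := m.+2.

(** The number of pairs of a permutation and a word with a spiral of period c in
    a given orientation. *)
Definition spiral_total c k := if odd c && (2 * c <= N) then k ^ (N - 2 * c) * num_primitive k c else 0.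

Definition trap_total (tau : option 'I_N.+1) k := if tau is Some c then spiral_total c k else k ^ m.

Lemma card_last_two k (x y : 'I_k) :
  #|[set s : {ffun 'I_N -> 'I_k} | (s (inord m) == x) && (s ord_max == y)]| = k ^ m.
Proof.
pose F (i : 'I_N) : pred 'I_k :=
  if i == m :> nat then pred1 x else if i == m.+1 :> nat then pred1 y else predT.
have -> : #|[set s : {ffun 'I_N -> 'I_k} | (s (inord m) == x) && (s ord_max == y)]| = #|family F|.
  apply: eq_card => s; rewrite inE; apply/andP/familyP => [[/eqP e1 /eqP e2] i|h].
    rewrite /F; case: eqP => [im|_].
      by rewrite inE -e1; apply/eqP; congr (s _); apply: val_inj; rewrite /= inordK.
    case: eqP => [im|_] //.
    by rewrite inE -e2; apply/eqP; congr (s _); apply: val_inj.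
  split.
    by have := h (inord m); rewrite /F inordK // eqxx.
  by have := h ord_max; rewrite /F /= ifF ?eqxx //; lia.
rewrite card_family foldrE big_map big_enum /= 2!big_ord_recr /=.
have F1 (i : 'I_N) : m <= i -> #|F i| = 1.
  rewrite /F; case: eqP => [_ _|ne h]; first exact: card1.
  by rewrite ifT ?card1 //; have := ltn_ord i; lia.
rewrite !F1 //= !muln1 (eq_bigr (fun=> k)) ?prod_nat_const ?card_ord // => i _.
have im := ltn_ord i; rewrite /F ifF /=; last lia.
by rewrite ifF ?card_ord //; lia.
Qed.

Lemma sum_trap_words k o tau : 0 < k ->
  \sum_(pi : 'S_N.+1) #|trap_words k (o, tau) pi| = trap_total tau k.
Proof.
move=> k0.
rewrite (eq_bigr (fun pi => #|trap_words k (false, tau) (mirror_perm o pi)|)); last first.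
  by move=> pi _; rewrite card_trap_words_mirror.
rewrite -(reindex_inj (inv_inj (@mirror_perm_inv N o)) (P := predT) (F := fun pi => #|trap_words k (false, tau) pi|)).
rewrite /trap_words (sum_card_swap (fun pi s => `[< compatible N (rank_of pi) (letter s) /\ trap k tau (rank_of pi) (letter s) >])).
case: tau => [c|] /=.
  rewrite (eq_bigr _ (fun s _ => card_spiral s c)) sum_asbool /spiral_total.
  case: ifP => [/andP[oc c2]|n].
    have c0 : 0 < c by case: (nat_of_ord c) oc.
    rewrite -(card_power_words k (N := N) c0 (ltn0Sn 1) c2).
    by apply: card_asbool_eq => s; split=> [[]|[]].
  apply/eqP; rewrite cards_eq0; apply/eqP/setP => s; rewrite !inE; apply/asboolP => -[oc c2 _ _].
  by rewrite oc c2 in n.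
rewrite (eq_bigr _ (fun s _ => card_bottom_trap s k0)) sum_asbool.
have kk : k.-1 < k by rewrite prednK.
rewrite -(card_last_two (Ordinal k0) (Ordinal kk)); apply: eq_card => s.
have e1 : letter s (N - 2) = s (inord m).
  by rewrite subn2 /= -letter_ord inordK.
have e2 : letter s (N - 1) = s ord_max by rewrite subn1 /= -letter_ord.
rewrite !inE e1 e2 -!val_eqE /=.
by apply/asboolP/andP => [[-> ->]//|[/eqP -> /eqP ->]].
Qed.

(** By uniqueness of the trap at most one set of spiral words is not empty. *)
Lemma card_compatible_words_split k pi : 0 < k ->
  #|compatible_words k pi| =
  #|[set s : {ffun 'I_N -> 'I_k} | `[< compatible N (rank_of pi) (letter s) /\ spiral_free N (rank_of pi) (letter s) >]]| +
  \sum_(o : bool) \sum_(c : 'I_N.+1) #|trap_words k (o, Some c) pi|.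
Proof.
move=> k0; set NO := [set s | _].
have noP s : s \in NO <-> s \in compatible_words k pi /\ forall o c, s \notin trap_words k (o, Some c) pi.
  rewrite !inE; split=> [/asboolP[cp no]|[/asboolP cp h]].
    split; first exact/asboolP.
    move=> o c; rewrite inE; apply/asboolP => -[_ /= b]; have [n1 n2] := no c.
    by case: o b => //= /(mirror_spiral_fin _ _ _ k0).
  apply/asboolP; split=> // c.
  have lec : odd c -> 2 * c <= N -> c < N.+1 by case: (c) => // c' _; lia.
  split=> b; have [oc c2 _ _ _] := b.
    have := h false (Ordinal (lec oc c2)); rewrite inE => /asboolP; apply; split=> //.
  have := h true (Ordinal (lec oc c2)); rewrite inE => /asboolP; apply; split=> //.
  exact/(mirror_spiral_fin _ _ _ k0).
rewrite pair_bigA /=.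
case: (pselect (exists oc : bool * 'I_N.+1, trap_words k (oc.1, Some oc.2) pi != set0)); last first.
  move=> nex; have e0 oc : trap_words k (oc.1, Some oc.2) pi = set0.
    by apply/eqP; apply: contraT => ne; case: nex; exists oc.
  rewrite big1 ?addn0; last by move=> oc _; rewrite e0 cards0.
  apply: eq_card => s; apply/idP/idP => [h|/noP[]//].
  by apply/noP; split=> // o c; rewrite (e0 (o, c)) inE.
case=> -[o c] /= /set0Pn[s0 h0].
have uq o' c' s : s \in trap_words k (o', Some c') pi -> (o', c') = (o, c).
  by move=> h; have [-> ->] := trap_unique k0 k0 h h0.
rewrite (bigD1 (o, c)) //= [X in _ + (_ + X)]big1 ?addn0; last first.
  move=> [o' c'] ne; apply/eqP; rewrite cards_eq0; apply: contraT => /set0Pn[s] /uq e.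
  by rewrite e eqxx in ne.
rewrite -(cardsID (trap_words k (o, Some c) pi)) addnC; congr (_ + _).
  apply: eq_card => s; rewrite in_setD; apply/andP/idP => [[h1 h2]|/noP[h2 h1] //].
  apply/noP; split=> // o' c'; apply: contra h1 => h.
  by have [<- <-] := uq _ _ _ h.
apply: eq_card => s; rewrite inE andb_idl // !inE => /asboolP[h _]; exact/asboolP.
Qed.

Lemma sum_compatible_words k : 0 < k ->
  \sum_(pi : 'S_N.+1) #|compatible_words k pi| =
  k ^ N + \sum_(c < N) k ^ (N - c.+1) * num_primitive k c.+1 + \sum_(o : bool) \sum_(c : 'I_N.+1) spiral_total c k.
Proof.
move=> k0; rewrite (eq_bigr _ (fun pi _ => card_compatible_words_split pi k0)) big_split /=.
congr (_ + _); last first.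
  rewrite exchange_big; apply: eq_bigr => o _; rewrite exchange_big; apply: eq_bigr => c _.
  by rewrite sum_trap_words.
rewrite (sum_card_swap (fun pi s => `[< compatible N (rank_of pi) (letter s) /\ spiral_free N (rank_of pi) (letter s) >])).
rewrite (eq_bigr _ (fun s _ => card_spiral_free s (ltn0Sn _) k0)).
under eq_bigr do rewrite -add1n.
rewrite big_split /= sum_nat_const card_ffun !card_ord muln1; congr (_ + _).
rewrite (sum_card_swap (fun s (c : 'I_N) => `[< primitive_suffix (letter s) N c.+1 >])).
apply: eq_bigr => c _.
rewrite -[in X in k ^ (N - X)](mul1n c.+1) -(card_power_words k (N := N)) ?mul1n //.
by apply: card_asbool_eq => s; split=> [h|[]].
Qed.

Lemma sum_identity k : 0 < k ->
  \sum_(2 <= j < k.+1) multichoose N.+1 (k - j) * b N.+1 j +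
  \sum_(tau : bool * option 'I_N.+1) \sum_(1 <= j < k.+1) multichoose (width tau).-1 (k - j) * trap_total tau.2 j =
  \sum_(pi : 'S_N.+1) #|compatible_words k pi|.
Proof.
move=> k0.
rewrite -(eq_bigr _ (fun pi _ => (perm_identity pi k0).2)) big_split /=; congr (_ + _).
  have Nb pi : 2 <= Nbar pi := (@perm_identity m pi k k0).1.
  transitivity (\sum_(2 <= j < k.+1) \sum_(pi : 'S_N.+1) if Nbar pi == j then multichoose N.+1 (k - j) else 0).
    apply: eq_big_nat => j _; rewrite -big_mkcond /= sum_nat_const mulnC; congr (_ * _).
    by rewrite /b cardsE; apply: eq_card.
  rewrite exchange_big; apply: eq_bigr => pi _ /=.
  case: leqP => h.
    rewrite (bigD1_seq (Nbar pi)) ?iota_uniq ?mem_index_iota ?Nb ?ltnS //= eqxx.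
    by rewrite big1 ?addn0 // => j /negbTE; rewrite eq_sym => ->.
  rewrite big_nat big1 // => j /andP[_ jk].
  by case: eqP => // e; move: h jk; rewrite e ltnS ltnNge => /negbTE ->.
rewrite [RHS]exchange_big; apply: eq_bigr => -[o tau] _ /=.
rewrite [RHS]exchange_big; apply: eq_big_nat => j /andP[j0 _].
by rewrite -big_distrr /= sum_trap_words.
Qed.

Lemma split_types (F : bool * option 'I_N.+1 -> nat) :
  \sum_tau F tau = \sum_(o : bool) (F (o, None) + \sum_(c : 'I_N.+1) F (o, Some c)).
Proof.
rewrite (eq_bigr (fun tau => F (tau.1, tau.2))); last by case.
rewrite -(pair_bigA _ (fun o t => F (o, t))) /=; apply: eq_bigr => o _.
rewrite (bigD1 None) //=; congr (_ + _).
rewrite (reindex_onto (@Some _) (fun t => odflt ord0 t)); last by case.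
by apply: eq_bigl => c; rewrite /= eqxx.
Qed.

(** The terms for j = k of the sum over spirals cancel against the compatible
    words with a spiral; those of the sum over extreme traps remain and turn k^2
    into k^2 - 2. *)
Lemma weighted_count k : 0 < k ->
  \sum_(2 <= j < k.+1) multichoose N.+1 (k - j) * b N.+1 j + 2 * k ^ m +
  2 * \sum_(1 <= j < k) j ^ m +
  2 * (\sum_(c < N.+1) \sum_(1 <= j < k) multichoose c.-1 (k - j) * spiral_total c j) =
  k ^ N + \sum_(c < N) k ^ (N - c.+1) * num_primitive k c.+1.
Proof.
move=> k0; have := sum_identity k0; rewrite sum_compatible_words // split_types.
rewrite !big_bool /= /width /=.
have lastj (F : nat -> nat) : \sum_(1 <= j < k.+1) F j = \sum_(1 <= j < k) F j + F k.
  by rewrite big_nat_recr.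
have e1 : \sum_(1 <= j < k.+1) multichoose 1 (k - j) * j ^ m = \sum_(1 <= j < k) j ^ m + k ^ m.
  rewrite lastj subnn multichoose0 mul1n; congr (_ + _); apply: eq_bigr => j _.
  by rewrite /multichoose add1n /= binn mul1n.
have e2 : \sum_(c < N.+1) \sum_(1 <= j < k.+1) multichoose c.-1 (k - j) * spiral_total c j =
   \sum_(c < N.+1) \sum_(1 <= j < k) multichoose c.-1 (k - j) * spiral_total c j + \sum_(c < N.+1) spiral_total c k.
  by rewrite -big_split; apply: eq_bigr => c _; rewrite lastj subnn multichoose0 mul1n.
rewrite e1 e2.
move: (\sum_(2 <= j < k.+1) _) (\sum_(1 <= j < k) _) (\sum_(c < N.+1) spiral_total c k)
  (\sum_(c < N.+1) _) (\sum_(c < N) _) (k ^ N) (k ^ m) => A B C D E F G; lia.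
Qed.

End Totals.

(** * Inversion of the multiset weights *)

Section Inversion.
Local Open Scope ring_scope.

(** The coefficient of X^q in (1 - X)^c (1 - X)^(-n). *)
Definition altsum c n q : int :=
  \sum_(u < q.+1) (-1) ^+ u * 'C(c, u)%:Z * (multichoose n (q - u))%:Z.

Lemma altsum_pascal c n q : altsum c.+1 n q.+1 = altsum c n q.+1 - altsum c n q.
Proof.
rewrite /altsum [LHS]big_ord_recl [in RHS]big_ord_recl /= !bin0 -addrA; congr (_ + _).
rewrite -sumrB; apply: eq_bigr => u _.
rewrite /bump /= add1n binS PoszD subSS exprS; ring.
Qed.

Lemma altsum_multichoose c n q : altsum c n.+1 q.+1 = altsum c n q.+1 + altsum c n.+1 q.
Proof.
rewrite /altsum [LHS]big_ord_recr [in RHS]big_ord_recr /= subnn !multichoose0.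
rewrite addrAC -big_split /=; congr (_ + _); apply: eq_bigr => u _.
rewrite subSn ?leq_ord // multichoose_pascal PoszD; ring.
Qed.

(** By the two recurrences, the exponents c and n can be lowered together. *)
Lemma altsum_diag n q : altsum n n q = (q == 0%N)%:Z.
Proof.
elim: n q => [|n IH] [|q].
- by rewrite /altsum big_ord1 multichoose0 bin0.
- rewrite /altsum big1 // => -[[|u] hu] _ /=.
    by rewrite subn0 multichoose0n mulr0.
  by rewrite bin0n mulr0 mul0r.
- by rewrite /altsum big_ord1 multichoose0 bin0.
- by rewrite altsum_pascal altsum_multichoose addrK IH.
Qed.

Lemma invert_multichoose n k (f g : nat -> int) :
  (forall j, (2 <= j <= k)%N -> g j = \sum_(2 <= i < j.+1) (multichoose n (j - i))%:Z * f i) ->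
  (2 <= k)%N ->
  f k = \sum_(2 <= j < k.+1) (-1) ^+ (k - j) * 'C(n, k - j)%:Z * g j.
Proof.
move=> h k2.
rewrite (eq_big_nat _ _ (F2 := fun j => \sum_(2 <= i < k.+1 | (i <= j)%N)
    (-1) ^+ (k - j) * 'C(n, k - j)%:Z * ((multichoose n (j - i))%:Z * f i))); last first.
  move=> j /andP[j2 jk]; rewrite h; last lia.
  rewrite mulr_sumr [RHS]big_nat_cond [LHS]big_nat_cond.
  rewrite -[LHS]big_nat_cond (big_nat_widen _ _ k.+1) //.
  rewrite -[RHS]big_nat_cond; apply: eq_bigl => i; rewrite andTb ltnS //.
rewrite (exchange_big_dep xpredT) //=.
have inner i : (2 <= i <= k)%N ->
    \sum_(2 <= j < k.+1 | (i <= j)%N) (-1) ^+ (k - j) * 'C(n, k - j)%:Z * ((multichoose n (j - i))%:Z * f i) =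
    ((k - i)%N == 0%N)%:Z * f i.
  move=> /andP[i2 ik].
  rewrite -(altsum_diag n (k - i)) /altsum mulr_suml.
  have -> : \sum_(2 <= j < k.+1 | (i <= j)%N) (-1) ^+ (k - j) * 'C(n, k - j)%:Z * ((multichoose n (j - i))%:Z * f i) =
     \sum_(i <= j < k.+1) (-1) ^+ (k - j) * 'C(n, k - j)%:Z * ((multichoose n (j - i))%:Z * f i).
    by rewrite (big_nat_widenl i 2).
  rewrite big_nat_rev -{1}[i]add0n big_addn subSn // big_mkord; apply: eq_bigr => u _.
  have uk := leq_ord u.
  have -> : (i + k.+1 - (u + i).+1 = k - u)%N by lia.
  have -> : (k - (k - u) = u)%N by lia.
  have -> : (k - u - i = k - i - u)%N by lia.
  by rewrite mulrA.
rewrite (eq_big_nat _ _ (F2 := fun i => ((k - i)%N == 0%N)%:Z * f i)); last first.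
  by move=> i hi; apply: inner; lia.
rewrite big_nat_recr //= subnn eqxx mul1r big1_seq ?add0r // => i /andP[_].
rewrite mem_index_iota => /andP[i2 ik].
by rewrite subn_eq0 leqNgt ik mul0r.
Qed.

End Inversion.

Local Open Scope ring_scope.

(** * The formula of the theorem *)

Lemma Posz_exp (k e : nat) : k%:Z ^+ e = (k ^ e)%N :> int.
Proof. by rewrite -[RHS]natz natrX natz. Qed.

Lemma Posz_sum (I : Type) (s : seq I) (P : pred I) (F : I -> nat) :
  ((\sum_(i <- s | P i) F i)%N : int) = \sum_(i <- s | P i) (F i : int).
Proof. exact: (big_morph Posz PoszD (erefl _)). Qed.

Lemma a_num_primitive m k : (0 < k)%N ->
  a m.+3 k = (\sum_(c < m.+2) k ^ (m.+2 - c.+1) * num_primitive k c.+1)%N :> int.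
Proof.
move=> k0; rewrite /a big_add1 big_mkord Posz_sum; apply: eq_bigr => c _.
rewrite psi_num_primitive // PoszM Posz_exp; congr (Posz (k ^ _)%N * _).
by rewrite -subnDA addn1 subSS.
Qed.

Lemma spiral_sum m k : (0 < k)%N ->
  \sum_(1 <= c < ((m.+3 - 1) %/ 2).+1 | odd c) \sum_(1 <= j < k)
           'C(c + k - j - 2, k - j)%:Z * j%:Z ^+ (m.+3 - 2 * c - 1) * psi j c =
  (\sum_(c < m.+3) \sum_(1 <= j < k) multichoose c.-1 (k - j) * spiral_total m c j)%N :> int.
Proof.
move=> k0.
pose G c := (\sum_(1 <= j < k) multichoose c.-1 (k - j) * (j ^ (m.+2 - 2 * c) * num_primitive j c))%N.
transitivity (\sum_(1 <= c < ((m.+3 - 1) %/ 2).+1 | odd c) (G c : int)).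
  rewrite big_nat_cond [RHS]big_nat_cond; apply: eq_bigr => c /andP[/andP[c1 _] _].
  rewrite Posz_sum; apply: eq_big_nat => j /andP[j1 jk].
  rewrite psi_num_primitive // Posz_exp !PoszM mulrA /multichoose; congr (Posz 'C(_, _)%N * Posz (j ^ _)%N * _); lia.
rewrite -Posz_sum; congr Posz.
rewrite (big_nat_widenl 1 0) // (big_nat_widen 0 _ m.+3); last by lia.
rewrite big_mkord big_mkcond; apply: eq_bigr => c _.
rewrite /spiral_total; case: (boolP (odd c && (2 * c <= m.+2)%N)) => h.
  by rewrite ifT //; have := leq_ord c; case: (nat_of_ord c) h => // c' h _; lia.
rewrite ifF; last by apply: contraNF h; lia.
by rewrite big1 // => j _; rewrite muln0.
Qed.

Lemma p_eq_sum m k : (0 < k)%N ->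
  p m.+3 k = \sum_(2 <= j < k.+1) (multichoose m.+3 (k - j))%:Z * (b m.+3 j)%:Z.
Proof.
move=> k0; have h := weighted_count m k0.
have e3 : (m.+3 - 3 = m)%N by lia.
rewrite /p a_num_primitive // spiral_sum // !e3.
have e1 : \sum_(1 <= j < k) j%:Z ^+ m = (\sum_(1 <= j < k) j ^ m)%N :> int.
  by rewrite Posz_sum; apply: eq_bigr => j _; rewrite Posz_exp.
have e2 : \sum_(2 <= j < k.+1) (multichoose m.+3 (k - j))%:Z * (b m.+3 j)%:Z =
   (\sum_(2 <= j < k.+1) multichoose m.+3 (k - j) * b m.+3 j)%N :> int.
  by rewrite Posz_sum; apply: eq_bigr => j _; rewrite PoszM.
have -> : (k%:Z ^+ 2 - 2) * k%:Z ^+ m = (k ^ m.+2)%N%:Z - 2 * (k ^ m)%N%:Z.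
  by rewrite mulrBl -exprD add2n !Posz_exp.
rewrite e1 e2.
move: h; move: (\sum_(2 <= j < k.+1) _)%N (\sum_(1 <= j < k) _)%N
  (\sum_(c < m.+3) _)%N (\sum_(c < m.+2) _)%N (k ^ m.+2)%N (k ^ m)%N => A B D E F H; lia.
Qed.

Theorem theorem6p8 (n k : nat) (hn : (3 <= n)%N) (hk : (2 <= k)%N) :
  p n k = \sum_(2 <= j < k.+1) 'C(n + k - j - 1, k - j)%:Z * (b n j)%:Z
  /\
  (b n k)%:Z = \sum_(2 <= j < k.+1) (-1) ^+ (k - j) * 'C(n, k - j)%:Z * p n j.
Proof.
have [m ->] : exists m, n = m.+3 by exists (n - 3)%N; lia.
split.
  rewrite p_eq_sum; last lia.
  apply: eq_big_nat => j /andP[j2 jk]; congr (Posz 'C(_, _)%N * _); lia.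
apply: (@invert_multichoose m.+3 k (fun j => (b m.+3 j)%:Z) (fun j => p m.+3 j)) => // j /andP[j2 jk].
by rewrite p_eq_sum; last lia.
Qed.
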